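(* Let $X$ be a CB process with branching mechanism $\Phi$ given by $(\alpha,\beta,\pi)$, with natural filtration $(\mathcal{F}_t)$, and let $x>0$. Assume that either $\alpha=0$ and $\pi$ has bounded support, or $\Phi(\lambda)=c\lambda^\gamma$ with $c>0$ and $\gamma\in(1,2]$. Then for any $t\in[0,\infty)$ and any $\mathcal{F}_t$-measurable bounded random variable $F$, as $r\to\infty$, $$\mathbf{E}_x\left[F\,\Big|\,\sup_{s\in[0,\infty)}X_s>r\right]\to\frac1x\,\mathbf{E}_x[X_tF].$$
   Context: A branching mechanism is a function $\Phi(\lambda)=\alpha\lambda+\beta\lambda^2+\int_{(0,\infty)}(e^{-\lambda\theta}-1+\lambda\theta)\,\pi(d\theta)$, $\lambda\ge0$, with $\alpha\in\mathbb{R}$, $\beta\ge0$ and $\pi$ a $\sigma$-finite measure on $(0,\infty)$ (the Lévy measure) with $\int_{(0,\infty)}(\theta\wedge\theta^2)\,\pi(d\theta)<\infty$; the case $\Phi\equiv0$ is excluded. A CB process with branching mechanism $\Phi$ is an rcll $[0,\infty)$-valued Markov process $X=(X_t)_{t\ge0}$ such that, writing $\mathbf{P}_x$ for its law when $X_0=x$ and $\mathbf{E}_x$ for the expectation, $\mathbf{E}_x[e^{-\lambda X_t}]=e^{-xv_t(\lambda)}$ for $\lambda\ge0$, where $v_t(\lambda)$ is the unique locally bounded nonnegative solution of $v_t(\lambda)=\lambda-\int_0^t\Phi(v_s(\lambda))\,ds$. *)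

(* Defs.v *)
From HB Require Import structures.
From mathcomp Require Import all_boot all_order all_algebra.
From mathcomp Require Import all_classical all_reals all_analysis measurable_realfun.

Set Implicit Arguments.
Unset Strict Implicit.
Unset Printing Implicit Defensive.

Import Order.TTheory GRing.Theory Num.Theory.
Import numFieldNormedType.Exports.

Local Open Scope classical_set_scope.
Local Open Scope ring_scope.

(* A measure on (0, +oo) is represented by the measure on R that extends it by
   zero. *)
Definition levy_measure (R : realType) (nu : {measure set R -> \bar R}) : Prop :=
  [/\ nu `]-oo, 0]%classic = 0%E,
      sigma_finite [set: R] nu
    & (\int[nu]_(theta in `]0%R, +oo[) (Num.min theta (theta ^+ 2))%:E < +oo)%E].

Definition measure_support (R : realType) (nu : {measure set R -> \bar R}) :
    set R :=
  [set theta | forall U : set R, open U -> U theta -> (0 < nu U)%E].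

Definition branching_mechanism (R : realType) (alpha beta : R)
    (nu : {measure set R -> \bar R}) (lambda : R) : R :=
  alpha * lambda + beta * lambda ^+ 2 +
  \int[nu]_(theta in `]0, +oo[)
    (expR (- (lambda * theta)) - 1 + lambda * theta).

(* The locally bounded nonnegative solutions v of the integral equation
   v_t = lambda - \int_0^t Phi(v_s) ds; measurability is only there to make
   the integral meaningful. *)
Definition cumulant_solution (R : realType) (Phi : R -> R) (lambda : R)
    (v : R -> R) : Prop :=
  [/\ measurable_fun (`[0%R, +oo[%classic : set R) v,
      forall t : R, 0 <= t -> 0 <= v t,
      forall t : R, 0 <= t ->
        exists M : R, forall s : R, 0 <= s <= t -> v s <= M
    & forall t : R, 0 <= t ->
        v t = lambda - \int[lebesgue_measure]_(s in `[0, t]) Phi (v s)].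

(* Processes are indexed by all of R, but only their restriction to the times
   t >= 0 is ever constrained or used. *)
Definition process_events (R : realType) (d : measure_display)
    (T : measurableType d) (X : R -> {mfun T >-> R}) (t : R) : set (set T) :=
  [set A | exists (s : R) (B : set R),
     [/\ 0 <= s <= t, measurable B & A = X s @^-1` B]].

Definition natural_filtration (R : realType) (d : measure_display)
    (T : measurableType d) (X : R -> {mfun T >-> R}) (t : R) : set (set T) :=
  <<s process_events X t >>.

Definition filtration_measurable (R : realType) (d : measure_display)
    (T : measurableType d) (X : R -> {mfun T >-> R}) (t : R) (F : T -> R) :
    Prop :=
  forall B : set R, measurable B -> natural_filtration X t (F @^-1` B).

Definition rcll (R : realType) (f : R -> R) : Prop :=
  (forall t : R, 0 <= t -> f s @[s --> t^'+] --> f t) /\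
  (forall t : R, 0 < t -> cvg (f s @[s --> t^'-])).

(* [0, +oo[-valued time-homogeneous Markov process with respect to its natural
   filtration, P x being the law started from x; P x is only relevant for
   x >= 0. The last clause is P_x (X_(t + s) \in B | F_t) = P_(X_t) (X_s \in B),
   with the defining property of conditional probabilities spelled out. *)
Record markov_process (R : realType) (d : measure_display)
    (T : measurableType d) (X : R -> {mfun T >-> R})
    (P : R -> probability T R) : Prop := MarkovProcess {
  markov_ge0 : forall (t : R) (w : T), 0 <= t -> 0 <= X t w ;
  markov_start : forall x : R, 0 <= x -> P x [set w | X 0 w = x] = 1%E ;
  markov_measurable : forall (s : R) (B : set R), 0 <= s -> measurable B ->
    measurable_fun (`[0%R, +oo[%classic : set R)
      (fun x : R => P x (X s @^-1` B)) ;
  markov_property : forall (x s t : R) (A : set T) (B : set R),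
    0 <= x -> 0 <= s -> 0 <= t -> natural_filtration X t A -> measurable B ->
    P x (A `&` X (t + s) @^-1` B) =
      (\int[P x]_(w in A) P (X t w) (X s @^-1` B))%E }.

Record cb_process (R : realType) (d : measure_display) (T : measurableType d)
    (Phi : R -> R) (X : R -> {mfun T >-> R}) (P : R -> probability T R) :
    Prop := CBProcess {
  cb_markov : markov_process X P ;
  cb_rcll : forall w : T, rcll (fun t => X t w) ;
  cb_laplace : exists v : R -> R -> R,
    (forall lambda : R, 0 <= lambda ->
       cumulant_solution Phi lambda (fun t => v t lambda)) /\
    (forall x t lambda : R, 0 <= x -> 0 <= t -> 0 <= lambda ->
       ('E_(P x)[fun w => expR (- (lambda * X t w))])%E =
         (expR (- (x * v t lambda)))%:E) }.

(* The supremum is taken in \bar R, as a path may be unbounded. *)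
Definition sup_exceeds (R : realType) (d : measure_display)
    (T : measurableType d) (X : R -> {mfun T >-> R}) (r : R) : set T :=
  [set w | (r%:E < ereal_sup [set (X s w)%:E | s in `[0%R, +oo[])%E].

Definition cond_expectation (R : realType) (d : measure_display)
    (T : measurableType d) (P : probability T R) (F : T -> R) (A : set T) :
    \bar R :=
  ('E_P[fun w => (F w * \1_A w)%R] / P A)%E.

(* Main.v *)
Require Import Defs.
From HB Require Import structures.
From mathcomp Require Import all_boot all_order all_algebra.
From mathcomp Require Import all_classical all_reals all_analysis measurable_realfun.
From mathcomp Require Import ring lra.
Import Order.TTheory GRing.Theory Num.Theory.
Import numFieldNormedType.Exports.
Local Open Scope classical_set_scope.
Local Open Scope ring_scope.

(* Since the generator maps e^(-l y) to y Phi(l) e^(-l y), one looks for functions h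
   that are mixtures of exponentials and whose generator vanishes on [0, r]. If Phi
   is c l^(1 + a), then h(y) = (r - y)_+^a works because l^-(1 + a) is the Laplace
   transform of a power; if alpha = 0 and the jumps are at most M, then
   h(y) = (r + M - y)_+ works because h is affine at all points that can be reached
   in one jump from [0, r]. Mollifying h and approximating it by finite sums of
   exponentials, the Markov property and the formula for the Laplace transform
   suffice for optional stopping along the times t + n 2^-j, and one gets, for every
   event A of F_t,
     E[A; (1 - X_t/(r - 1))_+^a] <= P(A; X_s <= r for all s >= t)
                                 <= E[A; (1 - X_t/(r + M + 1))_+^a],
   with a = 1 in the second case. Hence r P(A; sup_(s >= t) X_s > r) tends to
   a E[X_t; A]. As E X_t = x does not depend on t, crossing r before time t only is
   negligible, and dividing by the case A = Omega gives the conditional law. *)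

(** The factor y of the generator and the infinite horizon shape the proof: a relative error eps in
    the generator costs eps times the total of del E[X; still below r] over all grid times. That
    total is bounded, uniformly in the mesh, by running the same stopping argument on -e^(-l y). Its
    finiteness also forces E[X; still below r] to 0, so surviving paths contribute h(0) times their
    probability; hence the normalisation of all bounds by h(0). Without mollification, the generator
    of h divided by y would be a multiple of a Dirac mass at r when Phi is a power. Averaging the
    kernel over s in (b, c) turns it into a bump, which exponential sums approximate uniformly. One
    construction serves both bounds: -h with (b, c) = (r - 1, r), as h vanishes beyond r, and h with
    (b, c) = (r + M, r + M + 1), as h is nearly harmonic on [0, r]. The bounded shift of r
    disappears in the limit. *)

(** The recursion p + (x^2 - p^2)/2 is the classical iteration for the square root of x^2: each step
    multiplies the error by 1 - (|x| + p)/2. It gives access to positive parts through max(0, w) =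
    (w + |w|)/2. *)
Lemma normr_poly_approx (R : realType) (eps : R) : 0 < eps ->
  exists p : {poly R}, forall x : R, `|x| <= 1 -> `| `|x| - p.[x] | <= eps.
Proof.
move=> eps0.
pose p_ := fix p_ (n : nat) : {poly R} :=
  if n is m.+1 then p_ m + 2^-1 *: ('X ^+ 2 - p_ m ^+ 2) else 0.
have key n x : `|x| <= 1 ->
    0 <= (p_ n).[x] <= `|x| /\ (`|x| - (p_ n).[x]) * (2 + n%:R * `|x|) <= 2 * `|x|.
  move=> x1; have a0 : 0 <= `|x| by [].
  have x2 : x ^+ 2 = `|x| ^+ 2 by rewrite real_normK ?num_real.
  (* The invariant bounds the error by 2 |x| / (2 + n |x|). *)
  elim: n => [|n [/andP[p0 pa] IH]] /=.
    by rewrite horner0 lexx a0 subr0 mul0r addr0 mulrC; split.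
  rewrite !hornerE.
  set q := (p_ n).[x] in p0 pa IH *; set a := `|x| in a0 x1 x2 pa IH *.
  rewrite x2 !expr2.
  have e0 : a - (q + 2^-1 * (a * a - q * q)) = (a - q) * (1 - (a + q) / 2) by field.
  split.
    apply/andP; split; last by rewrite -subr_ge0 e0 mulr_ge0//; nra.
    by nra.
  have nS : n.+1%:R = n%:R + 1 :> R by rewrite natr1.
  rewrite e0 nS; set m : R := n%:R in IH *.
  have m0 : 0 <= m by rewrite ler0n.
  apply: le_trans IH; rewrite -mulrA ler_wpM2l ?subr_ge0//.
  (* Dropping [q] >= 0 leaves the factor 1 - a/2, and (1 - a/2)(2 + (m + 1) a) <= 2 + m a carries
     the invariant over. *)
  have h1 : (1 - (a + q) / 2) * (2 + (m + 1) * a) <= (1 - a / 2) * (2 + (m + 1) * a).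
    rewrite ler_wpM2r//; last by lra.
    by rewrite addr_ge0// mulr_ge0// addr_ge0.
  apply: le_trans h1 _.
  have -> : (1 - a / 2) * (2 + (m + 1) * a) = 2 + m * a - (m + 1) * (a * a) / 2 by field.
  by rewrite lerBlDr lerDl divr_ge0// mulr_ge0 ?mulr_ge0// addr_ge0.
have [n neps] : exists n : nat, 2 / eps < n%:R.
  by exists (Num.bound (2 / eps)); rewrite archi_boundP// divr_ge0// ltW.
exists (p_ n) => x /(key n)[/andP[p0 pa] IH].
rewrite ger0_norm ?subr_ge0//.
have [x0|x0] := eqVneq `|x| 0; first by move: pa p0; rewrite x0; lra.
have {}x0 : 0 < `|x| by rewrite lt_def x0 /=.
have n0 : 0 < n%:R :> R by rewrite (le_lt_trans _ neps)// divr_ge0// ltW.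
set q := (p_ n).[x] in p0 pa IH *; set a := `|x| in x0 pa IH *.
set m : R := n%:R in IH n0 neps.
have h : (a - q) * m <= 2.
  rewrite -(ler_pM2r x0) -mulrA; apply: le_trans IH.
  by rewrite ler_wpM2l ?subr_ge0// lerDr.
rewrite -(ler_pM2r n0); apply: le_trans h _.
by rewrite mulrC -ler_pdivrMr// ltW.
Qed.

(** * Bumps and their approximation by exponential sums *)

Section bump.
Context {R : realType}.
Implicit Types (b c s y : R) (q : seq (R * R)).

(* A pair is a coefficient together with an exponent. *)
Definition expsum q y : R := \sum_(p <- q) p.1 * expR (- (p.2 * y)).

(** The shape of every operator that is diagonal on exponentials: the generator divided by y ([m] is
    [Phi]), integration against a kernel ([m] is its Laplace transform), translation ([m] is e^(-l
    y)), change of sign. *)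
Definition scale_coef (m : R -> R) q := [seq (p.1 * m p.2, p.2) | p <- q].

Lemma expsum_scale m q y :
  expsum (scale_coef m q) y = \sum_(p <- q) p.1 * m p.2 * expR (- (p.2 * y)).
Proof. by rewrite /expsum big_map. Qed.

Definition positive_exponents q := all (fun p => 0 < p.2) q.

Lemma positive_exponents_scale m q :
  positive_exponents (scale_coef m q) = positive_exponents q.
Proof. by rewrite /positive_exponents all_map. Qed.

(* As z = e^-s times a continuous function of z, a bump can be approximated by
   exponential sums with an error that still decays exponentially. *)
Definition bump b c s : R :=
  expR (- s) * Num.max 0 ((expR (- s) - expR (- c)) * (expR (- b) - expR (- s))).

Lemma bump_ge0 b c s : 0 <= bump b c s.
Proof. by rewrite mulr_ge0 ?expR_ge0// le_max lexx. Qed.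

Lemma bump_out b c s : b <= c -> ~~ (b < s < c) -> bump b c s = 0.
Proof.
move=> bc; rewrite negb_and -!leNgt => /orP sbc.
rewrite /bump (max_idPl _) ?mulr0//.
have h2 : expR (- c) <= expR (- b) by rewrite ler_expR lerN2.
case: sbc => [sb|cs].
  have h1 : expR (- b) <= expR (- s) by rewrite ler_expR lerN2.
  by nra.
have h1 : expR (- s) <= expR (- c) by rewrite ler_expR lerN2.
by nra.
Qed.

Lemma continuous_expRN : continuous (fun s : R => expR (- s)).
Proof.
by move=> s; apply: continuous_comp; [exact: opp_continuous|exact: continuous_expR].
Qed.

Lemma measurable_bump b c (D : set R) : measurable_fun D (bump b c).
Proof.
have mE : measurable_fun setT (fun s : R => expR (- s)).
  by apply: measurableT_comp; [exact: measurable_expR|exact: oppr_measurable].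
apply/measurable_funTS/measurable_funM => //; apply: measurable_maxr => //.
by apply: measurable_funM; exact: measurable_funB.
Qed.

(** With z = e^(-s) the bump is z max(0, w) for a quadratic w with |w| <= 1 on [0, 1], and max(0, w)
    is close to the polynomial (w + p(w))/2. *)
Lemma bump_approx b c eps : 0 <= b -> b <= c -> 0 < eps ->
  exists2 q, positive_exponents q &
    forall s, 0 <= s -> `|bump b c s - expsum q s| <= eps * expR (- s).
Proof.
move=> b0 bc eps0; have [p pP] := normr_poly_approx _ _ eps0.
pose W : {poly R} := ('X - (expR (- c))%:P) * ((expR (- b))%:P - 'X).
pose r : {poly R} := 2^-1 *: (W + (p \Po W)).
(* The prefactor z raises every power by one, so that no exponent is 0. *)
exists [seq (r`_i, i.+1%:R) | i <- iota 0 (size r)].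
  by rewrite /positive_exponents all_map; apply/allP => i _ /=; rewrite ltr0n.
move=> s s0; rewrite /expsum big_map.
have -> : \sum_(i <- iota 0 (size r)) r`_i * expR (- (i.+1%:R * s))
    = expR (- s) * r.[expR (- s)].
  rewrite horner_coef.
  have -> : iota 0 (size r) = index_iota 0 (size r) by rewrite /index_iota subn0.
  rewrite mulr_sumr big_mkord /=.
  apply: eq_bigr => i _.
  by rewrite -mulrN mulrC expRM_natl exprS mulrA mulrC mulrCA mulrA.
rewrite /bump -mulrBr normrM ger0_norm ?expR_ge0// mulrC ler_wpM2r ?expR_ge0//.
rewrite /r !hornerE horner_comp !hornerE.
set z := expR (- s); set z1 := expR (- c); set z2 := expR (- b).
have zb : 0 <= z <= 1 by rewrite expR_ge0 -expR0 ler_expR oppr_le0.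
have z1b : 0 <= z1 <= 1 by rewrite expR_ge0 -expR0 ler_expR oppr_le0 (le_trans b0).
have z2b : 0 <= z2 <= 1 by rewrite expR_ge0 -expR0 ler_expR oppr_le0.
set w := (z - z1) * (z2 - z).
have w1 : `|w| <= 1.
  rewrite normrM -[leRHS]mulr1 ler_pM//; rewrite ler_norml; lra.
have := pP _ w1; set pw := p.[w] => h.
have -> : Num.max 0 w - 2^-1 * (w + pw) = 2^-1 * (`|w| - pw).
  by rewrite maxC maxr_absE subr0 addr0; field.
rewrite normrM ger0_norm ?invr_ge0// (le_trans _ h)// ler_piMl//.
by rewrite invf_le1// ler1n.
Qed.

End bump.

(** * Linear combinations and restriction of integrals *)

Lemma integrable_mulrl (d : measure_display) (T : measurableType d) (R : realType)
    (mu : {measure set T -> \bar R}) (D : set T) (f : T -> R) (c : R) :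
  measurable D -> mu.-integrable D (EFin \o f) ->
  mu.-integrable D (EFin \o (fun x => c * f x)).
Proof. by move=> mD intf; have := integrableZl mD c intf. Qed.

Lemma integrable_subr (d : measure_display) (T : measurableType d) (R : realType)
    (mu : {measure set T -> \bar R}) (D : set T) (f g : T -> R) :
  measurable D -> mu.-integrable D (EFin \o f) -> mu.-integrable D (EFin \o g) ->
  mu.-integrable D (EFin \o (fun x => f x - g x)).
Proof. by move=> mD intf intg; have := integrableB mD intf intg. Qed.

Lemma integrable_lincomb (d : measure_display) (T : measurableType d) (R : realType)
    (mu : {measure set T -> \bar R}) (D : set T) (I : eqType) (r : seq I)
    (c : I -> R) (F : I -> T -> R) :
  measurable D -> (forall i, i \in r -> mu.-integrable D (EFin \o F i)) ->
  mu.-integrable D (EFin \o (fun x => \sum_(i <- r) c i * F i x)) /\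
  \int[mu]_(x in D) (\sum_(i <- r) c i * F i x) =
    \sum_(i <- r) c i * \int[mu]_(x in D) F i x.
Proof.
move=> mD; elim: r => [|i r IH] iF.
  have -> : (fun x => \sum_(i <- [::]) c i * F i x) = cst 0.
    by apply/funext => x; rewrite big_nil.
  by rewrite big_nil Rintegral_cst// mul0r; split => //; exact: integrable0.
have -> : (fun x => \sum_(j <- i :: r) c j * F j x) =
    (fun x => c i * F i x + \sum_(j <- r) c j * F j x).
  by apply/funext => x; rewrite big_cons.
have [|ir er] := IH; first by move=> j jr; apply: iF; rewrite inE jr orbT.
have iFi := iF i (mem_head _ _).
have ii := integrable_mulrl _ _ _ _ _ _ (c i) mD iFi.
split; first by have := integrableD mD ii ir.
by rewrite RintegralD// er RintegralZl// big_cons.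
Qed.

Lemma integral_subset_eq0 (d : measure_display) (T : measurableType d) (R : realType)
    (mu : {measure set T -> \bar R}) (D E : set T) (f : T -> \bar R) :
  E `<=` D -> (forall x, D x -> ~ E x -> f x = 0%E) ->
  (\int[mu]_(x in D) f x = \int[mu]_(x in E) f x)%E.
Proof.
move=> ED f0; rewrite -[in RHS](setIidr ED) integral_mkcondr.
apply: eq_integral => x /set_mem Dx; rewrite patchE; case: ifPn => // /negP xE.
by apply: f0 => // Ex; apply: xE; rewrite inE.
Qed.

(** * Kernels with known Laplace transforms *)

Section laplace.
Context {R : realType}.
Local Notation mu := (@lebesgue_measure R).
Implicit Types (w W f : R -> R) (q : seq (R * R)).

Definition has_laplace w W :=
  [/\ measurable_fun (`[0, +oo[%classic : set R) w,
      forall s, 0 <= s -> 0 <= w s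
    & forall lambda, 0 < lambda ->
        (\int[mu]_(s in `[0%R, +oo[) (expR (- (lambda * s)) * w s)%:E =
          (W lambda)%:E)%E].

Lemma measurable_expRN (D : set R) (lambda : R) :
  measurable_fun D (fun s : R => expR (- (lambda * s))).
Proof.
apply/measurable_funTS/measurableT_comp; first exact: measurable_expR.
exact/measurableT_comp.
Qed.

Lemma measurable_expsum (D : set R) q : measurable_fun D (expsum q).
Proof.
by apply: measurable_sum => p; apply: measurable_funM => //; exact: measurable_expRN.
Qed.

Lemma has_laplace_integrable w W lambda : has_laplace w W -> 0 < lambda ->
  mu.-integrable (`[0, +oo[) (EFin \o (fun s => expR (- (lambda * s)) * w s)).
Proof.
move=> [mw w0 Ww] l0; apply/integrableP; split.
  by apply/measurable_EFinP/measurable_funM => //; exact: measurable_expRN.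
apply: le_lt_trans (ltry (W lambda)); rewrite -Ww// le_eqVlt; apply/orP; left.
apply/eqP/eq_integral => s; rewrite inE/= in_itv/= andbT => s0.
by rewrite /= ger0_norm// mulr_ge0 ?expR_ge0 ?w0.
Qed.

Lemma has_laplace_Rintegral w W lambda : has_laplace w W -> 0 < lambda ->
  \int[mu]_(s in `[0, +oo[) (expR (- (lambda * s)) * w s) = W lambda.
Proof. by move=> [_ _ Ww] l0; rewrite /Rintegral Ww. Qed.

(** An error eps e^(-s) integrated against [w] costs eps times the transform at 1. A merely uniform
    error would not do, since s^a is not integrable. *)
Lemma laplace_approx w W f q eps : has_laplace w W ->
  measurable_fun (`[0, +oo[%classic : set R) f -> positive_exponents q ->
  (forall s, 0 <= s -> `|f s - expsum q s| <= eps * expR (- s)) ->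
  mu.-integrable (`[0, +oo[) (EFin \o (fun s => f s * w s)) /\
  `|\int[mu]_(s in `[0, +oo[) (f s * w s) - \sum_(p <- q) p.1 * W p.2| <= eps * W 1.
Proof.
move=> wW mf q0 fq; have mD : measurable (`[0%R, +oo[%classic : set R) by [].
have [mw w0 _] := wW.
have [iq eq] : mu.-integrable (`[0, +oo[) (EFin \o (fun s => expsum q s * w s)) /\
    \int[mu]_(s in `[0, +oo[) (expsum q s * w s) = \sum_(p <- q) p.1 * W p.2.
  have -> : (fun s => expsum q s * w s) =
      (fun s => \sum_(p <- q) p.1 * (expR (- (p.2 * s)) * w s)).
    by apply/funext => s; rewrite mulr_suml; apply: eq_bigr => p _; rewrite mulrA.
  have ip p : p \in q -> mu.-integrable (`[0, +oo[)
      (EFin \o (fun s => expR (- (p.2 * s)) * w s)).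
    by move=> pq; apply: has_laplace_integrable wW _; exact: (allP q0).
  have [iS ->] := integrable_lincomb _ _ _ mu _ _ q fst _ (measurable_itv _) ip.
  split => //; apply: eq_big_seq => p pq.
  by rewrite (has_laplace_Rintegral _ _ _ wW)//; exact: (allP q0).
have i1 := has_laplace_integrable _ _ 1 wW ltr01.
have ieps : mu.-integrable (`[0, +oo[)
    (EFin \o (fun s => eps * (expR (- (1 * s)) * w s))) by exact: integrable_mulrl.
have idiff : mu.-integrable (`[0, +oo[) (EFin \o (fun s => (f s - expsum q s) * w s)).
  apply: le_integrable ieps => //.
    apply/measurable_EFinP/measurable_funM => //; apply: measurable_funB => //.
    exact: measurable_expsum.
  move=> s /=; rewrite in_itv/= andbT => s0; rewrite lee_fin.
  rewrite normrM (ger0_norm (w0 _ s0)) mulrA mul1r normrM (ger0_norm (w0 _ s0)).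
  by rewrite ler_wpM2r ?w0// (le_trans (fq _ s0))// ler_norm.
have fE : (fun s => f s * w s) = (fun s => (f s - expsum q s) * w s + expsum q s * w s).
  by apply/funext => s; rewrite -mulrDl subrK.
split; first by rewrite fE; exact: (integrableD _ idiff iq).
rewrite fE RintegralD// eq addrK.
apply: (le_trans (le_normr_Rintegral _ _)) => //.
rewrite -(has_laplace_Rintegral _ _ 1 wW ltr01) -RintegralZl//.
apply: le_Rintegral => //; first exact: integrable_norm.
move=> s /=; rewrite in_itv/= andbT => s0.
by rewrite normrM (ger0_norm (w0 _ s0)) mulrA mul1r ler_wpM2r ?w0// fq.
Qed.

(** [C] is Gamma(1 + a), shown finite by domination. *)
Lemma integral_powR_expR (a : R) : 0 < a -> a <= 1 ->
  exists2 C : R, 0 <= C &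
  (\int[mu]_(s in `[0%R, +oo[) (expR (- s) * s `^ a)%:E = C%:E)%E.
Proof.
move=> a0 a1.
(* [exponential_pdf 2^-1 s] is e^(-s/2)/2, and e^(-s) s^a <= e^(-s) (1 + s) <= 2 e^(-s/2). *)
have i4 : mu.-integrable (`[0, +oo[) (EFin \o (fun s => 4 * exponential_pdf 2^-1 s)).
  apply: integrable_mulrl => //; apply: (@integrableS _ _ _ _ setT) => //.
  by apply: integrable_exponential_pdf; rewrite invr_gt0.
have ia : mu.-integrable (`[0, +oo[) (EFin \o (fun s => expR (- s) * s `^ a)).
  apply: le_integrable i4 => //.
    apply/measurable_EFinP/measurable_funM.
      apply/measurable_funTS/measurableT_comp; first exact: measurable_expR.
      exact: oppr_measurable.
    by apply/measurable_funTS; exact: measurable_powR.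
  move=> s; rewrite /= in_itv/= andbT => s0; rewrite lee_fin.
  rewrite !ger0_norm ?mulr_ge0 ?expR_ge0 ?powR_ge0 ?exponential_pdf_ge0//.
  rewrite exponential_pdfE//.
  have sa : s `^ a <= 1 + s.
    have [s1|s1] := leP s 1.
      have := ge0_ler_powR (ltW a0) s0 ler01 s1.
      by rewrite powR1 => /le_trans; apply; rewrite lerDl.
    by rewrite (le_trans (ler1_powR (ltW s1) a1))// lerDr.
  have -> : expR (- s) = expR (- (s / 2)) * expR (- (s / 2)).
    by rewrite -expRD; congr expR; field.
  have e1 : 1 + s / 2 <= expR (s / 2) by exact: expR_ge1Dx.
  have e2 : expR (- (s / 2)) * expR (s / 2) = 1 by rewrite -expRD addNr expR0.
  have e3 : 0 < expR (- (s / 2)) by exact: expR_gt0.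
  rewrite mulNr [_^-1 * s]mulrC.
  set E := expR (- (s / 2)) in e2 e3 *.
  have -> : 4 * (2^-1 * E) = E * 2 by field.
  rewrite -mulrA ler_wpM2l ?(ltW e3)//.
  apply: (@le_trans _ _ (E * (2 * expR (s / 2)))); last by rewrite mulrCA e2 mulr1.
  by rewrite ler_wpM2l ?(ltW e3)//; lra.
exists (\int[mu]_(s in `[0, +oo[) (expR (- s) * s `^ a)).
  by apply: Rintegral_ge0 => s _; rewrite mulr_ge0 ?expR_ge0 ?powR_ge0.
by rewrite /Rintegral fineK//; exact: integrable_fin_num.
Qed.

(** The substitution t = l (s - y) reduces all y and l to one Gamma integral: the shift produces
    e^(-l y), the scaling l^-(1 + a). *)
Lemma has_laplace_powR (a : R) : 0 < a -> a <= 1 -> exists2 C : R, 0 <= C &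
  forall y, 0 <= y -> has_laplace (fun s => Num.max 0 (s - y) `^ a)
    (fun lambda => C * lambda `^ (- (1 + a)) * expR (- (lambda * y))).
Proof.
move=> a0 a1; have [C C0 CE] := integral_powR_expR _ a0 a1; exists C => // y y0.
split.
- apply/measurable_funTS/(measurableT_comp (measurable_powR _)).
  by apply: measurable_maxr => //; exact: measurable_funB.
- by move=> s _; exact: powR_ge0.
move=> l l0.
have dF (s : R) : is_derive s 1 (fun s : R => l * (s - y)) l.
  by apply: is_derive_eq; rewrite subr0 /GRing.scale/= mulr1.
have F' : (fun s : R => l * (s - y))^`()%classic = cst l.
  by apply/funext => s; rewrite derive1E; exact: derive_val.
have cE := @continuous_expRN R.
have := @increasing_ge0_integration_by_substitutiony R (fun s => l * (s - y))
  (fun t => expR (- t) * t `^ a) y.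
rewrite F' subrr mulr0 CE => H.
have {}H : (C%:E = \int[mu]_(s in `[y, +oo[)
    ((expR (l * y) * l `^ (1 + a)) * (expR (- (l * s)) * Num.max 0 (s - y) `^ a))%:E)%E.
  rewrite H//.
  - apply: eq_integral => s; rewrite inE/= in_itv/= andbT => ys.
    congr EFin; rewrite mulrfctE /= (max_idPr _) ?subr_ge0// powRM ?subr_ge0 ?(ltW l0)//.
    rewrite powRD ?(gt_eqF l0) ?implybT// powRr1 ?(ltW l0)//.
    rewrite mulrBr opprB expRD; ring.
  - by move=> u v _ _ uv /=; rewrite ltr_pM2l// ltrD2r.
  - by move=> u _; exact: cst_continuous.
  - exact: is_cvg_cst.
  - exact: is_cvg_cst.
  - split; first by move=> u _; exact: ex_derive.
    apply: cvg_at_right_filter; apply: cvgM; first exact: cvg_cst.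
    by apply: cvgB; [exact: cvg_id|exact: cvg_cst].
  - apply: gt0_cvgMry => //; apply/cvgryPge => A; near=> u.
    by rewrite lerBrDr; near: u; exact: nbhs_pinfty_ge.
  - apply/continuous_within_itvcyP; split.
      move=> u; rewrite in_itv/= andbT => u0; apply: cvgM; first exact: cE.
      have : {for u, continuous (fun t : R => t `^ a)}.
        apply: differentiable_continuous; apply/derivable1_diffP/derivable_powR.
        by rewrite in_itv/= u0.
      exact.
    apply: cvgM; first by apply: cvg_at_right_filter; exact: cE.
    by rewrite powR0 ?gt_eqF//; exact: powR_cvg0.
  - by move=> u _; rewrite mulr_ge0 ?expR_ge0 ?powR_ge0.
(* Below y the kernel is a power of 0, which is 0 because the exponent a is positive. *)
rewrite (integral_subset_eq0 _ _ _ mu _ `[y, +oo[%classic); last 2 first.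
- by move=> s /=; rewrite !in_itv/= !andbT; exact: le_trans.
- move=> s _ /=; rewrite in_itv/= andbT => /negP; rewrite -ltNge => sy.
  by rewrite (max_idPl _) ?subr_le0 ?(ltW sy)// powR0 ?gt_eqF// mulr0.
have K0 : 0 < expR (l * y) * l `^ (1 + a) by rewrite mulr_gt0 ?expR_gt0 ?powR_gt0.
set I := (\int[mu]_(_ in _) _)%E.
have CI : (C%:E = (expR (l * y) * l `^ (1 + a))%:E * I)%E.
  rewrite H /I -ge0_integralZl//.
  - apply/measurable_EFinP/measurable_funM; first exact: measurable_expRN.
    apply/measurable_funTS/(measurableT_comp (measurable_powR _)).
    by apply: measurable_maxr => //; exact: measurable_funB.
  - by move=> s _; rewrite lee_fin mulr_ge0 ?expR_ge0 ?powR_ge0.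
  - by rewrite lee_fin ltW.
have -> : (I = ((expR (l * y) * l `^ (1 + a))^-1)%:E * C%:E)%E.
  by rewrite CI muleA -EFinM mulVf ?lt0r_neq0// mul1e.
by rewrite -EFinM invfM -expRN -powRN; congr EFin; ring.
Unshelve. all: by end_near. Qed.

(** Taylor's formula with integral remainder: the jump integrand e^(-l theta) - 1 + l theta is l^2
    times the transform of the second-order kernel (theta - s)_+. *)
Lemma has_laplace_tent (theta : R) : 0 <= theta ->
  has_laplace (fun s => Num.max 0 (theta - s))
    (fun lambda => (expR (- (lambda * theta)) - 1 + lambda * theta) / lambda ^+ 2).
Proof.
move=> theta0; split.
- by apply/measurable_funTS/measurable_maxr => //; exact: measurable_funB.
- by move=> s _; rewrite le_max lexx.
move=> l l0.
(* A primitive of e^(-l u) (theta - u), found by integration by parts. *)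
pose F u := expR (- (l * u)) / l ^+ 2 - (theta - u) * expR (- (l * u)) / l.
have dF (u : R) : is_derive u 1 F (expR (- (l * u)) * (theta - u)).
  rewrite /F; apply: is_derive_eq; rewrite /GRing.scale/=.
  by field; rewrite gt_eqF.
have Fc (u : R) : {for u, continuous F}.
  by apply: differentiable_continuous; exact/derivable1_diffP/ex_derive.
transitivity (\int[mu]_(s in `[0%R, theta]) (expR (- (l * s)) * (theta - s))%:E)%E.
  rewrite (integral_subset_eq0 _ _ _ mu _ `[0, theta]%classic); last 2 first.
  - by move=> s /=; rewrite !in_itv/= andbT => /andP[].
  - move=> s /=; rewrite !in_itv/= andbT => -> /negP; rewrite -ltNge => ts.
    by rewrite (max_idPl _) ?subr_le0 ?(ltW ts)// mulr0.
  apply: eq_integral => s; rewrite inE/= in_itv/= => /andP[_ st].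
  by rewrite (max_idPr _) ?subr_ge0.
move: theta0; rewrite le_eqVlt => /predU1P[<-|theta0].
  by rewrite set_itv1 integral_set1 mulr0 oppr0 expR0 subrr add0r mul0r.
rewrite (@continuous_FTC2 _ _ F)//.
- rewrite /F subrr mulr0 oppr0 expR0 mul0r mul0r subr0 -EFinB; congr EFin.
  by field; rewrite gt_eqF.
- apply: continuous_subspaceT => u; apply: differentiable_continuous.
  by apply/derivable1_diffP; exact: ex_derive.
- split.
  + by move=> u _; exact: ex_derive.
  + by apply: cvg_at_right_filter; exact: Fc.
  + by apply: cvg_at_left_filter; exact: Fc.
- by move=> u _; rewrite derive1E; exact: derive_val.
Qed.
End laplace.

(** * Barriers, and the case of a power *)

Section barrier.
Context {R : realType}.
Local Notation mu := (@lebesgue_measure R).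
Implicit Types (Phi h : R -> R) (a b c y M : R) (q : seq (R * R)).

(* The generator maps e^(-l y) to y Phi(l) e^(-l y), so [expsum (scale_coef Phi q)]
   stands for the generator of [expsum q] divided by y. A barrier h is thus nearly
   subharmonic everywhere, nearly harmonic below b - M, and pinned between two
   powers; M bounds the jumps. *)
Definition barrier_property Phi a M := forall b c, 0 < b -> b < c ->
  exists h, [/\ 0 < h 0,
    forall y, 0 <= y -> h 0 * Num.max 0 (1 - y / b) `^ a <= h y,
    forall y, 0 <= y -> h y <= h 0 * Num.max 0 (1 - y / c) `^ a &
    forall eps, 0 < eps -> exists q, [/\ positive_exponents q,
      forall y, 0 <= y -> `|h y - expsum q y| <= eps,
      forall y, 0 <= y -> - eps <= expsum (scale_coef Phi q) y &
      forall y, 0 <= y -> y <= b - M -> expsum (scale_coef Phi q) y <= eps]].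

(* h(y) is the integral of bump(s) (s - y)_+^a: this is how the kernel s^a, whose
   Laplace transform is a multiple of l^-(1+a), acts on exponentials in y. *)
Lemma barrier_exists a b c : 0 < a -> a <= 1 -> 0 < b -> b < c ->
  exists C h, [/\ 0 <= C, 0 < h 0,
    forall y, 0 <= y -> h 0 * Num.max 0 (1 - y / b) `^ a <= h y,
    forall y, 0 <= y -> h y <= h 0 * Num.max 0 (1 - y / c) `^ a &
    forall eps q, 0 <= eps -> positive_exponents q ->
      (forall s, 0 <= s -> `|bump b c s - expsum q s| <= eps * expR (- s)) ->
      forall y, 0 <= y ->
        `|h y - expsum (scale_coef (fun l => C * l `^ (- (1 + a))) q) y| <= eps * C].
Proof.
move=> a0 a1 b0 bc; have [C C0 HC] := has_laplace_powR _ a0 a1.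
have c0 : 0 < c by exact: lt_trans bc.
have max0_le (u v : R) : u <= v -> Num.max 0 u <= Num.max 0 v.
  by move=> uv; rewrite ge_max !le_max lexx uv orbT.
pose w y s := Num.max 0 (s - y) `^ a.
pose h y := \int[mu]_(s in `[0, +oo[) (bump b c s * w y s).
have mb : measurable_fun (`[0, +oo[%classic : set R) (bump b c).
  exact: measurable_bump.
have mD : measurable (`[0%R, +oo[%classic : set R) by [].
have iw y : 0 <= y -> mu.-integrable (`[0, +oo[) (EFin \o (fun s => bump b c s * w y s)).
  move=> y0; have [q q0 Hq] := bump_approx _ _ _ (ltW b0) (ltW bc) ltr01.
  by have [] := laplace_approx _ _ _ _ _ (HC y y0) mb q0 Hq.
have i0 := iw 0 (lexx 0).
have hE (k : R) : h 0 * k = \int[mu]_(s in `[0, +oo[) (k * (bump b c s * w 0 s)).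
  by rewrite RintegralZl// mulrC.
(* Homogeneity of the kernel. As the bump lives on b < s < c, comparing s/b and s/c with 1 yields
   the two power bounds on h. *)
have wS (s t y : R) : 0 <= s -> 0 < t ->
    Num.max 0 (1 - y / t) `^ a * w 0 s = Num.max 0 (s - y * (s / t)) `^ a.
  move=> s0 t0; rewrite /w subr0 (max_idPr s0) -powRM ?le_max ?lexx//.
  by rewrite maxr_pMl// mul0r mulrBl mul1r mulrAC mulrA.
exists C, h; split => //.
(* Strict positivity of h(0): on the middle third of (b, c) each factor of the integrand is bounded
   below, and [k] is the product of these bounds. *)
- have m1 : b < (b + b + c) / 3 by rewrite ltr_pdivlMr//; lra.
  have m2 : (b + b + c) / 3 < (b + c + c) / 3 by rewrite ltr_pM2r//; lra.
  have m3 : (b + c + c) / 3 < c by rewrite ltr_pdivrMr//; lra.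
  set d1 := (b + b + c) / 3 in m1 m2; set d2 := (b + c + c) / 3 in m2 m3.
  pose k := expR (- c) * ((expR (- d2) - expR (- c)) * (expR (- b) - expR (- d1))) * b `^ a.
  have k0 : 0 < k.
    by rewrite mulr_gt0 ?powR_gt0// mulr_gt0 ?expR_gt0// mulr_gt0// subr_gt0 ltr_expR ltrN2.
  apply: (@lt_le_trans _ _ (k * (d2 - d1))); first by rewrite mulr_gt0 ?subr_gt0.
  have sub : `[d1, d2] `<=` (`[0%R, +oo[%classic : set R).
    move=> s /=; rewrite !in_itv/= andbT => /andP[+ _].
    by apply: le_trans; rewrite (le_trans (ltW b0))// ltW.
  have -> : k * (d2 - d1) = \int[mu]_(s in `[d1, d2]) k.
    by rewrite Rintegral_cst//= lebesgue_measure_itv/= lte_fin m2.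
  rewrite /h.
  apply: (@le_trans _ _ (\int[mu]_(s in `[d1, d2]) (bump b c s * w 0 s))).
    apply: le_Rintegral => //.
    + apply: measurable_bounded_integrable => //.
        by rewrite /= lebesgue_measure_itv/= lte_fin m2 -EFinB ltry.
      by exists `|k|; split; rewrite ?num_real// => t kt s _ /=; exact: ltW.
    + exact: integrableS i0.
    move=> s /=; rewrite in_itv/= => /andP[d1s sd2].
    have bs : b <= s by rewrite (le_trans (ltW m1)).
    have s0 : 0 <= s by rewrite (le_trans (ltW b0)).
    rewrite /k /w subr0 (max_idPr s0) ler_pM//.
    + rewrite mulr_ge0 ?expR_ge0// mulr_ge0// subr_ge0 ler_expR lerN2 ltW//.
    + exact: powR_ge0.
    + rewrite /bump ler_pM ?expR_ge0//.
      * by rewrite mulr_ge0// subr_ge0 ler_expR lerN2 ltW//.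
      * by rewrite ler_expR lerN2 (le_trans sd2)// ltW.
      * rewrite le_max; apply/orP; right.
        rewrite ler_pM// ?subr_ge0 ?ler_expR ?lerN2 ?(ltW m3) ?(ltW m1)//.
          by rewrite lerB// ler_expR lerN2.
        by rewrite lerB// ler_expR lerN2.
    + by apply: ge0_ler_powR => //; exact: ltW.
  rewrite /Rintegral fine_le//.
  + by apply: integrable_fin_num => //; exact: integrableS i0.
  + exact: integrable_fin_num.
  apply: ge0_subset_integral => //; first exact: (measurable_int mu i0).
  by move=> s _; rewrite lee_fin mulr_ge0 ?bump_ge0 ?powR_ge0.
- move=> y y0; rewrite hE; apply: le_Rintegral => //; [exact: integrable_mulrl|exact: iw|].
  move=> s /=; rewrite in_itv/= andbT => s0.
  rewrite mulrCA wS//.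
  have [/andP[bs sc]|nsbc] := boolP (b < s < c); last by rewrite bump_out ?(ltW bc)// !mul0r.
  rewrite ler_wpM2l ?bump_ge0//.
  apply: ge0_ler_powR; [exact: ltW|by rewrite nnegrE le_max lexx|
    by rewrite nnegrE le_max lexx|].
  by apply: max0_le; rewrite lerD2l lerN2 ler_peMr// ler_pdivlMr// mul1r ltW.
- move=> y y0; rewrite hE; apply: le_Rintegral => //; [exact: iw|exact: integrable_mulrl|].
  move=> s /=; rewrite in_itv/= andbT => s0.
  rewrite [leRHS]mulrCA wS//.
  have [/andP[bs sc]|nsbc] := boolP (b < s < c); last by rewrite bump_out ?(ltW bc)// !mul0r.
  rewrite ler_wpM2l ?bump_ge0//.
  apply: ge0_ler_powR; [exact: ltW|by rewrite nnegrE le_max lexx|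
    by rewrite nnegrE le_max lexx|].
  by apply: max0_le; rewrite lerD2l lerN2 ler_piMr// ler_pdivrMr// mul1r ltW.
move=> eps q eps0 q0 Hq y y0; rewrite expsum_scale.
have [_] := laplace_approx _ _ _ _ _ (HC y y0) mb q0 Hq.
rewrite powR1 mulr1 mul1r => H.
under eq_bigr do rewrite -mulrA.
apply: (le_trans H); rewrite ler_wpM2l// ler_piMr//.
by rewrite -expR0 ler_expR oppr_le0.
Qed.

(** [Phi] cancels the multiplier C l^-(1 + a) of the kernel, so the generator of h divided by y is
    c0 C times the bump: nonnegative, and zero up to b. Hence the margin 0, whatever the size of the
    jumps. *)
Lemma barrier_stable (c0 a : R) : 0 <= c0 -> 0 < a -> a <= 1 ->
  forall Phi, (forall l, 0 <= l -> Phi l = c0 * l `^ (1 + a)) ->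
  barrier_property Phi a 0.
Proof.
move=> c00 a0 a1 Phi PhiE b c b0 bc.
have [C [h [C0 h0 h1 h2 H]]] := barrier_exists _ _ _ a0 a1 b0 bc.
exists h; split => // eps eps0.
(* An error eps/k in the bump becomes C eps/k in h and c0 C eps/k in the generator; both stay below
   eps. *)
pose k := 1 + C + c0 * C.
have k0 : 0 < k by rewrite ltr_pwDl ?ltr_pwDl ?mulr_ge0.
have ek0 : 0 < eps / k by rewrite divr_gt0.
have [q q0 Hq] := bump_approx _ _ _ (ltW b0) (ltW bc) ek0.
exists (scale_coef (fun l => C * l `^ (- (1 + a))) q).
have gE y : expsum (scale_coef Phi (scale_coef (fun l => C * l `^ (- (1 + a))) q)) y =
    c0 * C * expsum q y.
  rewrite expsum_scale big_map /expsum mulr_sumr; apply: eq_big_seq => p pq /=.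
  have p0 : 0 < p.2 := allP q0 _ pq.
  rewrite PhiE ?(ltW p0)// powRN.
  have := powR_gt0 (1 + a) p0; set z := p.2 `^ _ => z0.
  by field; rewrite gt_eqF.
have gb y : 0 <= y -> `|c0 * C * bump b c y - c0 * C * expsum q y| <= eps.
  move=> y0; rewrite -mulrBr normrM ger0_norm ?mulr_ge0//.
  apply: (@le_trans _ _ (c0 * C * (eps / k))).
    rewrite ler_wpM2l ?mulr_ge0// (le_trans (Hq _ y0))// ler_piMr ?(ltW ek0)//.
    by rewrite -expR0 ler_expR oppr_le0.
  rewrite mulrCA ler_piMr ?(ltW eps0)// ler_pdivrMr// mul1r /k; lra.
split.
- by rewrite positive_exponents_scale.
- move=> y y0; apply: le_trans (H _ _ (ltW ek0) q0 Hq y y0) _.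
  by rewrite mulrAC ler_pdivrMr// ler_wpM2l ?(ltW eps0)// /k; have := mulr_ge0 c00 C0; lra.
- move=> y y0; rewrite gE; have := gb y y0; rewrite ler_distlC => /andP[+ _].
  by apply: le_trans; rewrite -[leLHS]add0r lerD2r mulr_ge0 ?mulr_ge0 ?bump_ge0.
- move=> y y0; rewrite subr0 => yb; rewrite gE; have := gb y y0.
  rewrite bump_out ?(ltW bc)// ?mulr0 ?sub0r ?normrN; first exact: le_trans (ler_norm _).
  by rewrite negb_and -!leNgt yb.
Qed.

End barrier.

(** * Properties of the branching mechanism, and the case of bounded jumps *)

Section mechanism.
Context {R : realType}.
Implicit Types (Phi : R -> R) (nu : {measure set R -> \bar R}).

(** What the two cases share. [tame_small] is criticality, Phi'(0) = 0, and gives E X_t = x.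
    Continuity is from the left because v_s(l) approaches l from below. [tame_pos] makes the drift
    of e^(-l y) strict, which bounds the occupation. *)
Record tame_mechanism Phi : Prop := TameMechanism {
  tame_ge0 : forall l, 0 <= l -> 0 <= Phi l ;
  tame_nd : forall l l', 0 <= l -> l <= l' -> Phi l <= Phi l' ;
  tame_left_cont : forall l eps, 0 < l -> 0 < eps -> exists2 d, 0 < d &
    forall l', 0 <= l' -> l - d <= l' -> l' <= l -> Phi l - eps <= Phi l' ;
  tame_small : forall eps, 0 < eps -> exists2 d, 0 < d &
    forall l, 0 < l -> l <= d -> Phi l <= eps * l ;
  tame_pos : exists2 l0, 0 < l0 & 0 < Phi l0 }.

Lemma tame_stable (c gamma : R) Phi : 0 < c -> 1 < gamma ->
  (forall l, 0 <= l -> Phi l = c * l `^ gamma) -> tame_mechanism Phi.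
Proof.
move=> c0 g1 PhiE; have g0 : 0 < gamma by exact: lt_trans g1.
split.
- by move=> l l0; rewrite PhiE// mulr_ge0 ?powR_ge0// ltW.
- move=> l l' l0 ll'; have l'0 := le_trans l0 ll'.
  by rewrite !PhiE// ler_wpM2l ?(ltW c0)//; apply: ge0_ler_powR => //; exact: ltW.
- move=> l eps l0 eps0.
  have : {for l, continuous (fun t : R => c * t `^ gamma)}.
    apply: cvgM; first exact: cvg_cst.
    have : {for l, continuous (fun t : R => t `^ gamma)}.
      apply: differentiable_continuous; apply/derivable1_diffP/derivable_powR.
      by rewrite in_itv/= l0.
    exact.
  move=> /cvgrPdist_le /(_ _ eps0) /nbhs_ballP[d /= d0 Hd].
  exists (d / 2); first by rewrite divr_gt0.
  move=> l' l'0 ld l'l; rewrite !PhiE ?(ltW l0)//.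
  have := Hd l'; rewrite /ball/= => /(_ _).
  have h : `|l - l'| < d.
    rewrite ger0_norm ?subr_ge0// (@le_lt_trans _ _ (d / 2))//; first by lra.
    by rewrite ltr_pdivrMr// ltr_pMr// ltr1n.
  by move=> /(_ h); rewrite ler_distl => /andP[_]; lra.
- move=> eps eps0.
  have a0 : 0 < gamma - 1 by rewrite subr_gt0.
  exists ((eps / c) `^ (gamma - 1)^-1); first by rewrite powR_gt0// divr_gt0.
  move=> l l0 ld; rewrite PhiE ?(ltW l0)// -mulr_powRB1 ?(ltW l0)// mulrCA mulrC.
  rewrite ler_wpM2r ?(ltW l0)// mulrC -ler_pdivlMr//.
  have := ge0_ler_powR (ltW a0) (ltW l0) (powR_ge0 _ _) ld.
  by rewrite -powRrM mulVf ?gt_eqF// powRr1// divr_ge0// ltW.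
- by exists 1 => //; rewrite PhiE// powR1 mulr1.
Qed.

(** The support is defined point by point, so its complement has to be covered by countably many
    null sets: the rational intervals of measure 0. *)
Lemma bounded_support_null nu : bounded_set (measure_support nu) ->
  exists2 M, 0 < M & nu `]M, +oo[%classic = 0%E.
Proof.
move=> [M0 [M0r HM]].
(* [HM] holds for all constants strictly above [M0], hence [M0 + 1]; the maximum makes [M]
   positive. *)
pose M := Num.max 1 (M0 + 1).
have M1 : 0 < M by rewrite lt_max ltr01.
exists M => //.
have {}HM theta : measure_support nu theta -> theta <= M.
  move=> sth; apply: le_trans (ler_norm _) _; apply: HM => //.
  by rewrite lt_max ltrDl ltr01 orbT.
pose I (pq : rat * rat) : set R := `]ratr pq.1, ratr pq.2[%classic.
pose F (n : nat) : set R :=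
  if unpickle n is Some pq then (if nu (I pq) == 0%E then I pq else set0)
  else set0.
have mF n : measurable (F n).
  by rewrite /F; case: unpickle => [pq|//]; case: ifP => // _; exact: measurable_itv.
have F0 n : nu (F n) = 0%E.
  by rewrite /F; case: unpickle => [pq|]; rewrite ?measure0//;
    case: ifP => [/eqP//|_]; rewrite measure0.
have sub : `]M, +oo[%classic `<=` \bigcup_n F n.
  move=> theta /=; rewrite in_itv/= andbT => Mt.
  have : ~ measure_support nu theta by move=> /HM; rewrite leNgt Mt.
  move=> /existsNP[U /not_implyP[oU /not_implyP[Ut /negP]]].
  rewrite -leNgt => nuU.
  have /nbhs_ballP[e /= e0 eU] : nbhs theta U by exact: open_nbhs_nbhs.
  have [p pI] : exists p : rat, (ratr p : R) \in `]theta - e, theta[.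
    by apply: rat_in_itvoo; lra.
  have [q qI] : exists q : rat, (ratr q : R) \in `]theta, theta + e[.
    by apply: rat_in_itvoo; lra.
  move: pI qI; rewrite !in_itv/= => /andP[p1 p2] /andP[q1 q2].
  exists (pickle (p, q)); [exact: Logic.I|rewrite /F pickleK].
  have Ipq : I (p, q) `<=` U.
    move=> z; rewrite /I/= in_itv/= => /andP[z1 z2]; apply: eU; rewrite /ball/=.
    by rewrite ltr_norml; apply/andP; split; lra.
  rewrite ifT; first by rewrite /I/= in_itv/= p2 q1.
  rewrite eq_le measure_ge0 andbT (le_trans _ nuU)//.
  apply: le_measure => //; rewrite ?inE//; first exact: measurable_itv.
  exact: open_measurable.
apply/eqP; rewrite eq_le measure_ge0 andbT.
have := measure_sigma_subadditive nu mF (measurable_itv _) sub.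
by move=> /le_trans; apply; rewrite eseries0.
Qed.

Definition jump_exponent (l theta : R) : R := expR (- (l * theta)) - 1 + l * theta.

Lemma jump_exponent_ge0 l theta : 0 <= jump_exponent l theta.
Proof. by rewrite /jump_exponent; have := expR_ge1Dx (- (l * theta)); lra. Qed.

Lemma jump_exponent_le l theta : 0 <= l -> 0 <= theta ->
  jump_exponent l theta <= l ^+ 2 * theta ^+ 2.
Proof.
move=> l0 t0; rewrite /jump_exponent -exprMn.
have z0 : 0 <= l * theta by rewrite mulr_ge0.
set z := l * theta in z0 *.
have e1 := expR_ge1Dx z; have e2 := expR_ge1Dx (- z).
have e3 : expR z * expR (- z) = 1 by rewrite expRN divff// expR_eq0.
have e4 : 0 < expR (- z) := expR_gt0 _.
have e5 : (1 + z) * expR (- z) <= expR z * expR (- z) by rewrite ler_wpM2r// ltW.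
have e6 : z * (1 - z) <= z * expR (- z) by rewrite ler_wpM2l.
by rewrite e3 in e5; rewrite expr2; lra.
Qed.

(** The derivative in l is theta (1 - e^(-l theta)), which lies between 0 and l theta^2. Integrated,
    this makes [Phi] monotone and locally Lipschitz. *)
Lemma jump_exponent_nd l l' theta : 0 <= theta -> 0 <= l -> l <= l' ->
  0 <= jump_exponent l' theta - jump_exponent l theta <=
    (l' - l) * (l' * theta ^+ 2).
Proof.
move=> t0 l0 ll'; rewrite /jump_exponent.
have d0 : 0 <= (l' - l) * theta by rewrite mulr_ge0// subr_ge0.
have e0 : expR (- (l * theta)) = expR (- (l' * theta)) * expR ((l' - l) * theta).
  by rewrite -expRD; congr expR; ring.
have e1 := expR_ge1Dx ((l' - l) * theta).
have e2 := expR_ge1Dx (- ((l' - l) * theta)).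
have e0' : expR (- (l' * theta)) = expR (- (l * theta)) * expR (- ((l' - l) * theta)).
  by rewrite -expRD; congr expR; ring.
have e4 : expR (- (l * theta)) <= 1 by rewrite -expR0 ler_expR oppr_le0 mulr_ge0.
have e5 : 1 - l' * theta <= expR (- (l' * theta)) := expR_ge1Dx _.
have e6 := expR_gt0 (- (l' * theta)); have e7 := expR_gt0 (- (l * theta)).
have -> : (l' - l) * (l' * theta ^+ 2) = ((l' - l) * theta) * (l' * theta) by ring.
have dE : (l' - l) * theta = l' * theta - l * theta by ring.
set d := (l' - l) * theta in d0 e0 e0' e1 e2 dE *.
set A := expR (- (l * theta)) in e0 e0' e4 e7 *.
set B := expR (- (l' * theta)) in e0 e0' e5 e6 *.
have e8 : A * (1 - d) <= B by rewrite e0' ler_wpM2l// ltW.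
have e9 : B * (1 + d) <= A by rewrite [in leRHS]e0 ler_wpM2l// ltW.
have e10 : d * (1 - l' * theta) <= d * B by rewrite ler_wpM2l.
have e11 : A * d <= d by rewrite ler_piMl.
by apply/andP; split; lra.
Qed.

Lemma measurable_jump_exponent l (D : set R) : measurable_fun D (jump_exponent l).
Proof.
apply: measurable_funD; first by apply: measurable_funB => //; exact: measurable_expRN.
by apply/measurable_funTS; exact: mulrl_measurable.
Qed.

Section bounded_jumps.
Variables (nu : {measure set R -> \bar R}) (beta M : R).
Hypotheses (beta0 : 0 <= beta) (M0 : 0 < M).
Hypothesis levy_nu : levy_measure nu.
Hypothesis nuM : nu `]M, +oo[%classic = 0%E.
Local Notation D := (`]0, M]%classic : set R).

Let mD : measurable D. Proof. exact: measurable_itv. Qed.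

Lemma integrable_sqr_jump : nu.-integrable D (EFin \o (fun theta : R => theta ^+ 2)).
Proof.
case: levy_nu => _ _ fin.
(* On ]0, M], theta^2 <= K min(theta, theta^2): bounded jumps upgrade the integrability of the Levy
   measure to a second moment. *)
pose K := Num.max 1 M.
have K0 : 0 < K by rewrite lt_max ltr01.
have mmin : measurable_fun setT (fun theta : R => Num.min theta (theta ^+ 2)).
  by apply: measurable_minr => //; exact: exprn_measurable.
have imin : nu.-integrable D (EFin \o (fun theta : R => K * Num.min theta (theta ^+ 2))).
  apply: integrable_mulrl => //; apply/integrableP; split.
    by apply/measurable_EFinP/measurable_funTS.
  apply: le_lt_trans fin.
  rewrite (eq_integral (fun theta : R => (Num.min theta (theta ^+ 2))%:E)); last first.
    move=> theta; rewrite inE/= in_itv/= => /andP[t0 _]; rewrite ger0_norm//.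
    by rewrite le_min (ltW t0) sqr_ge0.
  apply: ge0_subset_integral => //.
  - by apply/measurable_EFinP/measurable_funTS.
  - move=> theta /=; rewrite in_itv/= andbT => t0; rewrite lee_fin.
    by rewrite le_min (ltW t0) sqr_ge0.
  - by move=> theta /=; rewrite !in_itv/= andbT => /andP[].
apply: le_integrable imin => //.
  by apply/measurable_EFinP/measurable_funTS; exact: exprn_measurable.
move=> theta /=; rewrite in_itv/= => /andP[t0 tM]; rewrite lee_fin.
rewrite !ger0_norm ?sqr_ge0 ?mulr_ge0 ?(ltW K0) ?le_min ?(ltW t0) ?sqr_ge0//.
have K1 : 1 <= K by rewrite le_max lexx.
have KM : theta <= K by rewrite le_max tM orbT.
rewrite minEle; case: ifP => _; first by rewrite expr2 ler_wpM2r// ltW.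
by rewrite ler_peMl// sqr_ge0.
Qed.

Lemma integrable_jump_exponent l : 0 <= l ->
  nu.-integrable D (EFin \o jump_exponent l).
Proof.
move=> l0.
apply: le_integrable (integrable_mulrl _ _ _ _ _ _ (l ^+ 2) mD integrable_sqr_jump) => //.
  by apply/measurable_EFinP; exact: measurable_jump_exponent.
move=> theta /=; rewrite in_itv/= => /andP[t0 tM]; rewrite lee_fin.
rewrite !ger0_norm ?jump_exponent_ge0 ?mulr_ge0 ?sqr_ge0 ?(ltW t0)//.
by rewrite jump_exponent_le ?(ltW t0).
Qed.

Lemma branching_mechanismE l : branching_mechanism 0 beta nu l =
  beta * l ^+ 2 + \int[nu]_(theta in D) jump_exponent l theta.
Proof.
rewrite /branching_mechanism mul0r add0r; congr (_ + fine _).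
have mM : measurable (`]M, +oo[%classic : set R) by exact: measurable_itv.
have -> : D = (`]0, +oo[%classic `\` `]M, +oo[%classic : set R).
  apply/seteqP; split => theta /=; rewrite !in_itv/= !andbT.
    by move=> /andP[-> tM]; split => //; apply/negP; rewrite -leNgt.
  by move=> [-> /negP]; rewrite -leNgt.
apply: (ge0_negligible_integral mM) => //.
- by apply/measurable_EFinP; exact: measurable_jump_exponent.
- by move=> theta _; rewrite lee_fin jump_exponent_ge0.
Qed.

Local Notation Phi := (branching_mechanism 0 beta nu).

(** With [N] the second moment of the jumps and alpha = 0, Phi(l) <= (beta + N) l^2, which gives
    criticality, and Phi'(l) <= l (2 beta + N), which gives continuity. *)
Lemma tame_bounded_jumps : (exists2 l, 0 <= l & Phi l != 0) -> tame_mechanism Phi.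
Proof.
pose N := \int[nu]_(theta in D) theta ^+ 2.
have N0 : 0 <= N by apply: Rintegral_ge0 => theta _; exact: sqr_ge0.
have Phi_ge0 l : 0 <= l -> 0 <= Phi l.
  move=> l0; rewrite branching_mechanismE addr_ge0 ?mulr_ge0 ?sqr_ge0//.
  by apply: Rintegral_ge0 => theta _; exact: jump_exponent_ge0.
have Phi_le l : 0 <= l -> Phi l <= (beta + N) * l ^+ 2.
  move=> l0; rewrite branching_mechanismE mulrDl lerD2l mulrC -RintegralZl//; last first.
    exact: integrable_sqr_jump.
  apply: le_Rintegral => //; first exact: integrable_jump_exponent.
    by apply: integrable_mulrl => //; exact: integrable_sqr_jump.
  move=> theta /=; rewrite in_itv/= => /andP[t0 _].
  by rewrite jump_exponent_le ?(ltW t0).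
have Phi_diff l l' : 0 <= l -> l <= l' ->
    0 <= Phi l' - Phi l <= (l' - l) * (l' * (2 * beta + N)).
  move=> l0 ll'; have l'0 : 0 <= l' by exact: le_trans ll'.
  rewrite !branching_mechanismE.
  have -> : forall u v : R, beta * l' ^+ 2 + u - (beta * l ^+ 2 + v) =
      beta * ((l' - l) * (l' + l)) + (u - v) by move=> u v; ring.
  rewrite -RintegralB//; [|exact: integrable_jump_exponent..].
  have iB : nu.-integrable D
      (EFin \o (fun theta => jump_exponent l' theta - jump_exponent l theta)).
    by apply: integrable_subr => //; exact: integrable_jump_exponent.
  have h0 : 0 <= \int[nu]_(theta in D) (jump_exponent l' theta - jump_exponent l theta).
    apply: Rintegral_ge0 => theta /=; rewrite in_itv/= => /andP[t0 _].
    by have /andP[] := jump_exponent_nd _ _ _ (ltW t0) l0 ll'.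
  have h1 : \int[nu]_(theta in D) (jump_exponent l' theta - jump_exponent l theta) <=
      (l' - l) * l' * N.
    rewrite -RintegralZl//; last exact: integrable_sqr_jump.
    apply: le_Rintegral => //.
      by apply: integrable_mulrl => //; exact: integrable_sqr_jump.
    move=> theta /=; rewrite in_itv/= => /andP[t0 _]; rewrite -mulrA.
    by have /andP[] := jump_exponent_nd _ _ _ (ltW t0) l0 ll'.
  have h2 : 0 <= beta * ((l' - l) * (l' + l)) <= (l' - l) * l' * (2 * beta).
    rewrite !mulr_ge0 ?subr_ge0 ?addr_ge0//= mulrC -!mulrA ler_wpM2l ?subr_ge0//.
    by rewrite mulrA ler_wpM2r//; lra.
  by move: h0 h1 h2; lra.
move=> [l1 l10 Phil1]; split => //.
- by move=> l l' l0 ll'; have /andP[] := Phi_diff _ _ l0 ll'; lra.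
- move=> l eps l0 eps0.
  pose K := l * (2 * beta + N) + 1.
  have K0 : 0 < K by rewrite ltr_wpDl// mulr_ge0 ?addr_ge0 ?mulr_ge0// ltW.
  exists (eps / K) => [|l' l'0 ldl' l'l]; first by rewrite divr_gt0.
  have /andP[_ h] := Phi_diff _ _ l'0 l'l.
  rewrite lerBlDr -lerBlDl; apply: le_trans h _.
  apply: (@le_trans _ _ (eps / K * K)); last by rewrite divfK ?gt_eqF.
  rewrite ler_pM ?subr_ge0//; first by rewrite mulr_ge0 ?addr_ge0 ?mulr_ge0// ltW.
    by move: ldl'; lra.
  by rewrite /K lerDl.
- move=> eps eps0.
  have K0 : 0 < beta + N + 1 by rewrite ltr_wpDl ?addr_ge0.
  exists (eps / (beta + N + 1)) => [|l l0 ld]; first by rewrite divr_gt0.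
  apply: (le_trans (Phi_le _ (ltW l0))); rewrite expr2 mulrA ler_wpM2r ?(ltW l0)//.
  apply: (@le_trans _ _ ((beta + N + 1) * l)); first by rewrite ler_wpM2r ?(ltW l0)// lerDl.
  by rewrite mulrC -ler_pdivlMr.
exists l1; last by rewrite lt_def Phil1 Phi_ge0.
rewrite lt_def l10 andbT; apply: contra_neq Phil1 => ->.
by apply/eqP; rewrite eq_le Phi_ge0// (le_trans (Phi_le _ (lexx 0)))// expr0n mulr0.
Qed.

(* Phi(l) / l^2 is beta plus the nu-integral of the Laplace transforms of the tents
   (theta - u)_+, which vanish beyond M; positivity of these kernels controls the
   generator of the approximations. *)
Lemma barrier_bounded_jumps : barrier_property Phi 1 M.
Proof.
move=> b c b0 bc.
have [C [h [C0 h0 h1 h2 H]]] := barrier_exists _ _ _ ltr01 (lexx 1) b0 bc.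
exists h; split => // eps eps0.
have P1 : 0 <= Phi 1.
  rewrite branching_mechanismE addr_ge0 ?mulr_ge0 ?sqr_ge0//.
  by apply: Rintegral_ge0 => theta _; exact: jump_exponent_ge0.
pose k := 1 + C + C * Phi 1.
have CP : 0 <= C * Phi 1 by rewrite mulr_ge0.
have k0 : 0 < k by rewrite /k; lra.
have ek0 : 0 < eps / k by rewrite divr_gt0.
have [q q0 Hq] := bump_approx _ _ _ (ltW b0) (ltW bc) ek0.
set W := (fun l => C * l `^ (- (1 + 1))) in H.
have WE l : 0 < l -> W l = C / l ^+ 2.
  by move=> l0; rewrite /W powRN (_ : 1 + 1 = 2%:R :> R) ?powR_mulrn ?(ltW l0).
(* Up to the factor [C], the contribution of jumps of size theta to the generator, divided by y, of
   the approximating sum. *)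
pose S y theta :=
  \sum_(p <- q) (p.1 * expR (- (p.2 * y)) / p.2 ^+ 2) * jump_exponent p.2 theta.
have iS y : nu.-integrable D (EFin \o S y) /\ \int[nu]_(theta in D) S y theta =
    \sum_(p <- q) (p.1 * expR (- (p.2 * y)) / p.2 ^+ 2) *
      \int[nu]_(theta in D) jump_exponent p.2 theta.
  apply: (integrable_lincomb _ _ _ _ _ _ _ _ (fun p => jump_exponent p.2)) => //.
  by move=> p pq; apply: integrable_jump_exponent; exact: ltW (allP q0 _ pq).
exists (scale_coef W q).
have gE y : expsum (scale_coef Phi (scale_coef W q)) y =
    C * (beta * expsum q y + \int[nu]_(theta in D) S y theta).
  rewrite (iS y).2 /expsum !big_map /= !mulr_sumr -big_split/= mulr_sumr.
  apply: eq_big_seq => p pq /=; have p0 : 0 < p.2 := allP q0 _ pq.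
  by rewrite WE// branching_mechanismE; field; rewrite gt_eqF.
pose N := \int[nu]_(theta in D) jump_exponent 1 theta.
have Phi1 : Phi 1 = beta + N by rewrite branching_mechanismE expr1n mulr1.
have i1 : nu.-integrable D (EFin \o jump_exponent 1) by exact: integrable_jump_exponent.
(* For a function h whose second derivative is the bump, this is the Taylor remainder h(y + theta) -
   h(y) - theta h'(y), the exact jump term that [S] approximates. It is nonnegative, and zero if y +
   theta <= b. *)
pose V y theta := \int[lebesgue_measure]_(u in `[0, +oo[)
  (bump b c (y + u) * Num.max 0 (theta - u)).
have VS y theta : 0 <= y -> 0 < theta ->
    `|V y theta - S y theta| <= eps / k * jump_exponent 1 theta.
  move=> y0 t0.
  have mb : measurable_fun (`[0, +oo[%classic : set R) (fun u => bump b c (y + u)).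
    apply/measurable_funTS/measurableT_comp; first exact: measurable_bump.
    exact: measurable_funD.
  (* Translation by y multiplies the coefficient of e^(-l u) by e^(-l y), so one [q] serves all
     translates of the bump. *)
  have q'0 : positive_exponents (scale_coef (fun l => expR (- (l * y))) q).
    by rewrite positive_exponents_scale.
  have Hq' u : 0 <= u ->
      `|bump b c (y + u) - expsum (scale_coef (fun l => expR (- (l * y))) q) u|
        <= eps / k * expR (- u).
    move=> u0; have -> : expsum (scale_coef (fun l => expR (- (l * y))) q) u =
        expsum q (y + u).
      rewrite expsum_scale; apply: eq_bigr => p _.
      by rewrite -mulrA -expRD mulrDr opprD.
    apply: le_trans (Hq _ (addr_ge0 y0 u0)) _.
    by rewrite ler_wpM2l ?(ltW ek0)// ler_expR lerN2 lerDr.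
  have [_] := laplace_approx _ _ _ _ _ (has_laplace_tent _ (ltW t0)) mb q'0 Hq'.
  rewrite expr1n divr1 big_map /=; congr (`|_ - _| <= _); apply: eq_bigr => p _.
  by rewrite /= mulrA mulrAC.
have V0 y theta : 0 <= V y theta.
  by apply: Rintegral_ge0 => u _; rewrite mulr_ge0 ?bump_ge0// le_max lexx.
have V_eq0 y theta : 0 <= y -> y <= b - M -> theta <= M -> V y theta = 0.
  move=> y0 yb tM; rewrite /V.
  under eq_Rintegral => u.
    rewrite inE/= in_itv/= andbT => u0.
    have -> : bump b c (y + u) * Num.max 0 (theta - u) = 0.
      have [ut|tu] := leP theta u; first by rewrite (max_idPl _) ?mulr0// subr_le0.
      rewrite bump_out ?mul0r ?(ltW bc)// negb_and -!leNgt.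
      by apply/orP; left; lra.
    over.
  by rewrite Rintegral_cst// mul0r.
have Sge y : 0 <= y -> - (eps / k * N) <= \int[nu]_(theta in D) S y theta.
  move=> y0; rewrite -mulNr -RintegralZl//.
  apply: le_Rintegral => //; [exact: integrable_mulrl|exact: (iS y).1|].
  move=> theta /=; rewrite in_itv/= => /andP[t0 _].
  have := VS _ _ y0 t0; rewrite ler_distl => /andP[_].
  by have := V0 y theta; rewrite mulNr; lra.
have Sle y : 0 <= y -> y <= b - M -> \int[nu]_(theta in D) S y theta <= eps / k * N.
  move=> y0 yb; rewrite -RintegralZl//.
  apply: le_Rintegral => //; [exact: (iS y).1|exact: integrable_mulrl|].
  move=> theta /=; rewrite in_itv/= => /andP[t0 tM].
  have := VS _ _ y0 t0; rewrite V_eq0// sub0r normrN.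
  exact: le_trans (ler_norm _).
have bound : C * (eps / k * Phi 1) <= eps.
  rewrite (_ : C * (eps / k * Phi 1) = eps * (C * Phi 1 / k)); last by ring.
  by rewrite ler_piMr ?(ltW eps0)// ler_pdivrMr// mul1r /k; lra.
have Hq1 y : 0 <= y -> `|bump b c y - expsum q y| <= eps / k.
  move=> y0; apply: le_trans (Hq _ y0) _.
  by rewrite ler_piMr ?(ltW ek0)// -expR0 ler_expR oppr_le0.
split.
- by rewrite positive_exponents_scale.
- move=> y y0; apply: le_trans (H _ _ (ltW ek0) q0 Hq y y0) _.
  by rewrite mulrAC ler_pdivrMr// ler_wpM2l ?(ltW eps0)// /k; lra.
- move=> y y0; rewrite gE; apply: (@le_trans _ _ (- (C * (eps / k * Phi 1)))).
    by rewrite lerN2.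
  rewrite -mulrN ler_wpM2l// Phi1 mulrDr opprD lerD ?Sge//.
  rewrite mulrC -mulrN ler_wpM2l//.
  have := Hq1 _ y0; rewrite ler_distlC => /andP[+ _]; apply: le_trans.
  by rewrite -[leLHS]add0r lerD2r bump_ge0.
- move=> y y0 yb; rewrite gE; apply: le_trans bound.
  rewrite ler_wpM2l// Phi1 mulrDr lerD ?Sle//.
  rewrite mulrC ler_wpM2r//.
  have := Hq1 _ y0; rewrite bump_out ?(ltW bc)//; last first.
    by rewrite negb_and -!leNgt (le_trans yb)// gerBl ltW.
  by rewrite sub0r normrN; exact: le_trans (ler_norm _).
Qed.

End bounded_jumps.

End mechanism.

(** * Integration against a kernel *)

Section mixture.
Import HBNNSimple.

(** The hypothesis on sets is the case of indicators; simple functions and monotone convergence do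
    the rest. *)
Lemma ge0_integral_mixture (d1 d2 : measure_display) (T1 : measurableType d1)
    (T2 : measurableType d2) (R : realType) (P : {measure set T1 -> \bar R})
    (A : set T1) (g : T1 -> T2) (k : T1 -> {measure set T2 -> \bar R}) (f : T2 -> \bar R) :
  measurable A -> measurable_fun setT g ->
  (forall B, measurable B -> measurable_fun setT (k ^~ B)) ->
  (forall B, measurable B -> (P (A `&` g @^-1` B) = \int[P]_(x in A) k x B)%E) ->
  measurable_fun setT f -> (forall y, 0 <= f y)%E ->
  (\int[P]_(x in A) f (g x) = \int[P]_(x in A) \int[k x]_y f y)%E.
Proof.
move=> mA mg mk Pk mf f0.
pose f_ := nnsfun_approx measurableT mf.
have mf_ n : measurable_fun setT (EFin \o f_ n) by exact/measurable_EFinP.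
have nd_f_ y : {homo (fun n => (f_ n y)%:E) : m n / (m <= n)%N >-> (m <= n)%E}.
  by move=> m n mn; rewrite lee_fin; exact/lefP/nd_nnsfun_approx.
have cf_ y : (fun n => (f_ n y)%:E) @ \oo --> f y.
  by apply: cvg_nnsfun_approx => // z _; exact: f0.
have mI n : measurable_fun setT (fun x => \int[k x]_y (f_ n y)%:E)%E.
  by apply: (measurable_fun_integral_kernel mk _ (mf_ n)) => y; rewrite lee_fin.
have step n : (\int[P]_(x in A) (f_ n (g x))%:E = \int[P]_(x in A) \int[k x]_y (f_ n y)%:E)%E.
  have m1 r : measurable (f_ n @^-1` [set r]) by exact: measurable_sfunP.
  have ind0 (r : R) y : (0 <= (r * \1_(f_ n @^-1` [set r]) y)%:E)%E.
    by rewrite EFinM nnfun_muleindic_ge0.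
  have mind (r : R) : measurable_fun setT (fun y => (r * \1_(f_ n @^-1` [set r]) y)%:E).
    exact/measurable_EFinP/measurable_funM.
  under [LHS]eq_integral do rewrite fimfunE -fsumEFin//.
  rewrite ge0_integral_fsum//; last 1 first.
  - by move=> r; apply/measurable_funTS/(measurableT_comp (mind r)).
  under [RHS]eq_integral => x _.
    under eq_integral => y _ do rewrite fimfunE -fsumEFin//.
    rewrite ge0_integral_fsum//; over.
  rewrite ge0_integral_fsum//; last 2 first.
  - move=> r; apply/measurable_funTS.
    have [r0|r0] := leP 0%R r.
      apply: measurable_fun_integral_kernel => //.
    rewrite [X in measurable_fun _ X](_ : _ = cst 0%E)//; apply/funext => x.
    by rewrite integral0_eq// => y _; rewrite preimage_nnfun0// indic0 mulr0.
  - by move=> r x _; apply: integral_ge0 => y _; exact: ind0.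
  apply: eq_fsbigr => r _.
  have [r0|r0] := leP 0%R r; last first.
    rewrite !integral0_eq// => x _.
      by rewrite integral0_eq// => y _; rewrite preimage_nnfun0// indic0 mulr0.
    by rewrite preimage_nnfun0// indic0 mulr0.
  under [LHS]eq_integral do rewrite EFinM.
  rewrite ge0_integralZl//; last 1 first.
  - by apply/measurable_EFinP/measurable_funTS/measurableT_comp.
  rewrite (_ : (fun x => (\1_(f_ n @^-1` [set r]) (g x))%:E) =
    (fun x => (\1_(g @^-1` (f_ n @^-1` [set r])) x)%:E)); last first.
    by apply/funext => x; rewrite !indicE; congr (_%:R%:E); rewrite !inE.
  rewrite integral_indic//; last first.
    by rewrite -[X in measurable X]setTI; exact: mg.
  rewrite setIC Pk// -ge0_integralZl//; last 1 first.
  - exact/measurable_funTS/mk.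
  apply: eq_integral => x _; under [RHS]eq_integral do rewrite EFinM.
  have := integral_indic (k x) measurableT (m1 r); rewrite setIT => <-.
  by rewrite -ge0_integralZl//; exact/measurable_EFinP.
transitivity (\int[P]_(x in A) limn (fun n => (f_ n (g x))%:E))%E.
  by apply: eq_integral => x _; apply/esym/cvg_lim => //; exact: cf_.
rewrite monotone_convergence//; last 2 first.
- by move=> n; apply/measurable_funTS/(measurableT_comp (mf_ n)).
- by move=> n x _; rewrite lee_fin.
transitivity (limn (fun n => \int[P]_(x in A) \int[k x]_y (f_ n y)%:E))%E.
  by congr (limn _); apply/funext => n; exact: step.
have k0 n x : A x -> (0 <= \int[k x]_y (f_ n y)%:E)%E.
  by move=> _; apply: integral_ge0 => y _; rewrite lee_fin.
have knd x : A x -> {homo (fun n => \int[k x]_y (f_ n y)%:E)%E :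
    m n / (m <= n)%N >-> (m <= n)%E}.
  move=> _ m n mn; apply: ge0_le_integral => //.
  - by move=> y _; rewrite lee_fin.
  - exact: mf_.
  - exact: mf_.
  - by move=> y _; exact: nd_f_.
rewrite -(monotone_convergence _ mA (fun n => measurable_funTS (mI n)) k0 knd).
apply: eq_integral => x _; rewrite -monotone_convergence//.
- by apply: eq_integral => y _; apply/cvg_lim => //; exact: cf_.
by move=> n y _; rewrite lee_fin.
Qed.

End mixture.

(** * The natural filtration and the Markov property for functions *)

Section filtration.
Context {R : realType} {d : measure_display} {T : measurableType d}.
Variable X : R -> {mfun T >-> R}.
Implicit Types (s t : R) (A B : set T).

Lemma natural_filtration_measurable t A : natural_filtration X t A -> measurable A.
Proof.
apply: smallest_sub; first exact: sigma_algebra_measurable.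
move=> _ [s [B [_ mB ->]]].
by rewrite -[X in measurable X]setTI; exact: measurable_funPT.
Qed.

Lemma natural_filtration_nd s t A : s <= t ->
  natural_filtration X s A -> natural_filtration X t A.
Proof.
move=> st; move: A; apply: sub_smallest2r; first exact: smallest_sigma_algebra.
move=> _ [u [B [/andP[u0 us] mB ->]]].
by exists u, B; split => //; rewrite u0 (le_trans us).
Qed.

Lemma natural_filtrationI t A B : natural_filtration X t A ->
  natural_filtration X t B -> natural_filtration X t (A `&` B).
Proof. exact: (@measurableI _ (g_sigma_algebraType (process_events X t))). Qed.

Lemma natural_filtrationT t : natural_filtration X t setT.
Proof. exact: (@measurableT _ (g_sigma_algebraType (process_events X t))). Qed.

Lemma natural_filtration_preimage s t (B : set R) : 0 <= s -> s <= t ->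
  measurable B -> natural_filtration X t (X s @^-1` B).
Proof. by move=> s0 st mB; apply: sub_sigma_algebra; exists s, B; rewrite s0 st. Qed.

Lemma markov_ge0_integral (P : R -> probability T R) (x s t : R) (A : set T)
    (f : R -> \bar R) : markov_process X P ->
  0 <= x -> 0 <= s -> 0 <= t -> natural_filtration X t A ->
  measurable_fun setT f -> (forall y, 0 <= f y)%E ->
  (\int[P x]_(w in A) f (X (t + s) w) =
   \int[P x]_(w in A) \int[P (X t w)]_w' f (X s w'))%E.
Proof.
move=> HM x0 s0 t0 FA mf f0; have mA := natural_filtration_measurable _ _ FA.
pose k w : {measure set R -> \bar R} := distribution (P (X t w)) (X s).
transitivity (\int[P x]_(w in A) \int[k w]_y f y)%E.
  apply: ge0_integral_mixture => // [B mB|B mB].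
    (* [markov_measurable] concerns starting points in [0, +oo[, where [X t] takes its values. *)
    rewrite (_ : k ^~ B = (fun y => P y (X s @^-1` B)) \o X t)//.
    apply: (measurable_comp (F := (`[0, +oo[%classic : set R))) => //.
      by move=> _ [w _ <-]; rewrite /= in_itv/= andbT; exact: markov_ge0 HM _ _ t0.
    exact: markov_measurable HM s B s0 mB.
  exact: markov_property HM _ _ _ _ _ x0 s0 t0 FA mB.
by apply: eq_integral => w _; rewrite ge0_integral_distribution.
Qed.

End filtration.

(** * Short-time bounds for the cumulant *)

Section cumulant.
Context {R : realType}.
Variables (Phi : R -> R) (tame : tame_mechanism Phi).
Variables (l : R) (v : R -> R).
Hypotheses (l0 : 0 <= l) (vsol : cumulant_solution Phi l v).

Lemma cumulant_le t : 0 <= t -> v t <= l.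
Proof.
case: vsol => _ v0 _ vE t0; rewrite vE// gerBl; apply: Rintegral_ge0 => s /=.
by rewrite in_itv/= => /andP[s0 _]; apply: tame_ge0 tame _ _; exact: v0.
Qed.

Let integrable_Phi_v t : 0 <= t ->
  lebesgue_measure.-integrable (`[0, t]%classic : set R) (EFin \o (fun s => Phi (v s))).
Proof.
move=> t0; case: vsol => mv v0 _ _.
(* Composition with the positive part makes [Phi] monotone on the whole line, hence measurable. *)
have mPhi : measurable_fun setT (fun y : R => Phi (Num.max 0 y)).
  apply: nondecreasing_measurable => // y z yz; apply: tame_nd tame _ _ _ _.
    by rewrite le_max lexx.
  by rewrite ge_max !le_max lexx yz orbT.
apply: measurable_bounded_integrable => //.
- by rewrite /= lebesgue_measure_itv/=; case: ifP => _; rewrite -?EFinB ltry.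
- apply: (eq_measurable_fun (fun s => Phi (Num.max 0 (v s)))).
    move=> s; rewrite inE/= in_itv/= => /andP[s0 _].
    by rewrite (max_idPr _) ?v0.
  apply: (measurableT_comp mPhi); apply: measurable_funS mv => //.
  by move=> s /=; rewrite !in_itv/= andbT => /andP[].
exists (Phi l); split; rewrite ?num_real// => M lM s /=; rewrite in_itv/= => /andP[s0 _].
rewrite ger0_norm ?(tame_ge0 _ tame) ?v0//.
by rewrite (le_trans _ (ltW lM))//; apply: tame_nd tame _ _ _ _; rewrite ?v0 ?cumulant_le.
Qed.

Let Rintegral_itv_cst t (c : R) : 0 <= t ->
  \int[lebesgue_measure]_(s in (`[0, t]%classic : set R)) c = t * c.
Proof.
move=> t0; rewrite Rintegral_cst//= lebesgue_measure_itv/= lte_fin mulrC.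
by move: t0; rewrite le_eqVlt => /predU1P[<-|t0]; rewrite ?ltxx ?mul0r// t0 -EFinB subr0.
Qed.

Lemma cumulant_ge t : 0 <= t -> l - t * Phi l <= v t.
Proof.
move=> t0; case: (vsol) => _ v0 _ vE; rewrite vE// lerD2l lerN2 -Rintegral_itv_cst//.
apply: le_Rintegral => //.
- exact: integrable_Phi_v.
- apply: measurable_bounded_integrable => //.
    by rewrite /= lebesgue_measure_itv/=; case: ifP => _; rewrite -?EFinB ltry.
  by exists `|Phi l|; split; rewrite ?num_real// => M lM s _ /=; exact: ltW.
- move=> s /=; rewrite in_itv/= => /andP[s0 _].
  by apply: tame_nd tame _ _ _ _; rewrite ?v0 ?cumulant_le.
Qed.

(** The lower bound of [cumulant_ge], put back into the integral equation. With left continuity the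
    two bounds give l - v_t(l) = t Phi(l) + o(t). *)
Lemma cumulant_decrease t : 0 <= t -> 0 <= l - t * Phi l ->
  t * Phi (l - t * Phi l) <= l - v t.
Proof.
move=> t0 h0; case: (vsol) => _ v0 _ vE; rewrite vE// subKr -Rintegral_itv_cst//.
apply: le_Rintegral => //.
- apply: measurable_bounded_integrable => //.
    by rewrite /= lebesgue_measure_itv/=; case: ifP => _; rewrite -?EFinB ltry.
  by exists `|Phi (l - t * Phi l)|; split; rewrite ?num_real// => M lM s _ /=; exact: ltW.
- exact: integrable_Phi_v.
- move=> s /=; rewrite in_itv/= => /andP[s0 st].
  apply: tame_nd tame _ _ h0 _; apply: le_trans (cumulant_ge _ s0).
  by rewrite lerD2l lerN2 ler_wpM2r// (tame_ge0 _ tame).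
Qed.

End cumulant.

Lemma bounded_integrable_prob (d : measure_display) (T : measurableType d) (R : realType)
    (P : probability T R) (D : set T) (f : T -> R) (M : R) :
  measurable D -> measurable_fun D f -> (forall w, D w -> `|f w| <= M) ->
  P.-integrable D (EFin \o f).
Proof.
move=> mD mf fM; apply: measurable_bounded_integrable => //.
  by rewrite (le_lt_trans (probability_le1 P mD))// ltry.
exists M; split; rewrite ?num_real// => N MN w Dw.
by apply: le_trans (fM _ Dw) _; exact: ltW.
Qed.

(** * The generator as a difference quotient on exponential sums *)

Section expsum_estimates.
Context {R : realType}.
Variable Phi : R -> R.
Hypothesis tame : tame_mechanism Phi.
Variable v : R -> R -> R.
Hypothesis vsol : forall l, 0 <= l -> cumulant_solution Phi l (v ^~ l).
Implicit Types (q : seq (R * R)).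

(** The transition operator for time s sends e^(-l y) to e^(-v_s(l) y); for [u] equal to [v s] this
    is its action on [expsum q]. *)
Definition map_exponents (u : R -> R) q := [seq (p.1, u p.2) | p <- q].

Lemma expsum_map_exponents u q y :
  expsum (map_exponents u q) y = \sum_(p <- q) p.1 * expR (- (u p.2 * y)).
Proof. by rewrite /expsum big_map. Qed.

Lemma exp_increment_bound (l u y : R) : u <= l -> 0 <= u -> 0 <= y ->
  0 <= expR (- (u * y)) - expR (- (l * y)) - (l - u) * y * expR (- (l * y)) <=
  ((l - u) * y) ^+ 2.
Proof.
move=> ul u0 y0.
have z0 : 0 <= (l - u) * y by rewrite mulr_ge0// subr_ge0.
have E1 : expR (- (u * y)) = expR (- (l * y)) * expR ((l - u) * y).
  by rewrite -expRD; congr expR; ring.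
have E2 : expR (- (l * y)) = expR (- (u * y)) * expR (- ((l - u) * y)).
  by rewrite -expRD; congr expR; ring.
have u1 : expR (- (u * y)) <= 1 by rewrite -expR0 ler_expR oppr_le0 mulr_ge0.
have e1 := expR_ge1Dx ((l - u) * y); have e2 := expR_ge1Dx (- ((l - u) * y)).
have A0 := expR_gt0 (- (l * y)); have B0 := expR_gt0 (- (u * y)).
rewrite expr2; set z := (l - u) * y in z0 E1 E2 e1 e2 *.
set A := expR (- (l * y)) in E1 E2 A0 *; set B := expR (- (u * y)) in E1 E2 u1 B0 *.
have h1 : A * (1 + z) <= B by rewrite E1 ler_wpM2l// ltW.
have h2 : B * (1 - z) <= A by rewrite [leRHS]E2 ler_wpM2l// ltW.
have h3 : z * (B * (1 - z)) <= z * A by rewrite ler_wpM2l.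
have h4 : B * z * z <= z * z by rewrite -mulrA ler_piMl// mulr_ge0.
by apply/andP; split; lra.
Qed.

(** The error has to be eps del y rather than eps del: it will be summed over infinitely many grid
    times, and what is under control there is the sum of del E[X; still below r]. *)
Lemma exp_generator_error (l r eps : R) : 0 < l -> 0 <= r -> 0 < eps ->
  exists2 dl, 0 < dl & forall del, 0 < del -> del <= dl -> forall y, 0 <= y -> y <= r ->
    `|expR (- (v del l * y)) - expR (- (l * y)) - del * y * (Phi l * expR (- (l * y)))|
      <= eps * (del * y).
Proof.
move=> l0 r0 eps0.
have F0 := tame_ge0 _ tame l (ltW l0).
have [d1 d10 Hd1] := tame_left_cont _ tame l (eps / 2) l0 (divr_gt0 eps0 (ltr0n _ 2)).
pose K := (1 + Phi l) * (1 + Phi l) * (1 + r).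
have K0 : 0 < K by rewrite !mulr_gt0 ?ltr_wpDr.
(* In turn: left continuity of [Phi] within eps/2; l - del Phi(l) >= 0; a quadratic term ((l - v)
   y)^2 below del y eps/2, where [K] collects l - v <= del (1 + Phi(l)) and y <= r. *)
pose dl := Num.min (Num.min (d1 / (1 + Phi l)) (l / (1 + Phi l))) (eps / 2 / K).
have F1 : 0 < 1 + Phi l by rewrite ltr_wpDr.
exists dl; first by rewrite !lt_min !divr_gt0.
move=> del del0; rewrite !le_min => /andP[/andP[]].
rewrite !ler_pdivlMr// => dd1 ddl ddK y y0 yr.
have sol := vsol l (ltW l0).
have vl := cumulant_le _ tame _ _ sol _ (ltW del0).
have v0 : 0 <= v del l by case: sol => _ + _ _; apply; exact: ltW.
have dF : del * Phi l <= del * (1 + Phi l) by rewrite ler_wpM2l ?(ltW del0)// lerDr.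
have h0 : 0 <= l - del * Phi l by rewrite subr_ge0 (le_trans dF).
have vge := cumulant_ge _ tame _ _ sol _ (ltW del0).
have vdec := cumulant_decrease _ tame _ _ (ltW l0) sol _ (ltW del0) h0.
have PhiL : Phi l - eps / 2 <= Phi (l - del * Phi l).
  apply: Hd1 => //; first by rewrite lerD2l lerN2 (le_trans dF).
  by rewrite gerBl mulr_ge0// ltW.
have /andP[g1 g2] := exp_increment_bound _ _ _ vl v0 y0.
set u := v del l in vl v0 vge vdec g1 g2 *.
set A := expR (- (l * y)) in g1 g2 *; set B := expR (- (u * y)) in g1 g2 *.
have A1 : A <= 1 by rewrite -expR0 ler_expR oppr_le0 mulr_ge0// ltW.
have A0 : 0 < A := expR_gt0 _.
have ul0 : 0 <= l - u by rewrite subr_ge0.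
have ulF : l - u <= del * Phi l by rewrite lerBlDl -lerBlDr.
have dPhi : del * (Phi l - eps / 2) <= l - u.
  by apply: le_trans vdec; rewrite ler_wpM2l// ltW.
have yA0 : 0 <= y * A by rewrite mulr_ge0// ltW.
have yA1 : y * A <= y by rewrite ler_piMr.
have k1 : (del * Phi l - (l - u)) * (y * A) <= del * (eps / 2) * y.
  apply: (@le_trans _ _ (del * (eps / 2) * (y * A))).
    by rewrite ler_wpM2r//; lra.
  by rewrite ler_wpM2l// mulr_ge0 ?(ltW del0)// divr_ge0// ltW.
have k0 : 0 <= (del * Phi l - (l - u)) * (y * A) by rewrite mulr_ge0// subr_ge0.
have k2 : ((l - u) * y) ^+ 2 <= del * (eps / 2) * y.
  apply: (@le_trans _ _ ((del * (1 + Phi l)) ^+ 2 * (y * (1 + r)))).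
    rewrite exprMn expr2 ler_pM ?mulr_ge0 ?sqr_ge0//.
      by rewrite expr2 ler_pM// (le_trans ulF).
    by rewrite expr2 ler_wpM2l// (le_trans yr)// lerDr.
  have -> : (del * (1 + Phi l)) ^+ 2 * (y * (1 + r)) = del * y * (del * K) by rewrite /K; ring.
  have -> : del * (eps / 2) * y = del * y * (eps / 2) by ring.
  rewrite ler_wpM2l ?mulr_ge0 ?(ltW del0)//; lra.
rewrite ler_norml; apply/andP; split.
  have -> : B - A - del * y * (Phi l * A) =
    (B - A - (l - u) * y * A) - (del * Phi l - (l - u)) * (y * A) by ring.
  have dy : 0 <= eps * (del * y) by rewrite !mulr_ge0// ltW.
  have ed : del * (eps / 2) * y = eps * (del * y) / 2 by field.
  by lra.
have -> : B - A - del * y * (Phi l * A) =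
  (B - A - (l - u) * y * A) - (del * Phi l - (l - u)) * (y * A) by ring.
have dy : 0 <= eps * (del * y) by rewrite !mulr_ge0// ltW.
have ed : del * (eps / 2) * y = eps * (del * y) / 2 by field.
by lra.
Qed.

Lemma expsum_generator_error q (r eps : R) : positive_exponents q -> 0 <= r -> 0 < eps ->
  exists2 dl, 0 < dl & forall del, 0 < del -> del <= dl -> forall y, 0 <= y -> y <= r ->
    `|expsum (map_exponents (v del) q) y - expsum q y
      - del * y * expsum (scale_coef Phi q) y| <= eps * (del * y).
Proof.
move=> q0 r0; elim: q q0 eps => [|p q IH] /= q0 eps eps0.
  exists 1 => // del del0 _ y y0 _.
  by rewrite /expsum !big_nil subrr mulr0 subrr normr0 !mulr_ge0// ltW.
move: q0 => /andP[p0 q0].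
have e20 : 0 < eps / 2 by rewrite divr_gt0.
have [d1 d10 H1] := IH q0 _ e20.
have k0 : 0 < 1 + `|p.1| by rewrite ltr_wpDr.
have [d2 d20 H2] := exp_generator_error _ _ _ p0 r0 (divr_gt0 e20 k0).
exists (Num.min d1 d2); first by rewrite lt_min d10.
move=> del del0; rewrite le_min => /andP[dd1 dd2] y y0 yr.
have h1 := H1 _ del0 dd1 _ y0 yr; have h2 := H2 _ del0 dd2 _ y0 yr.
rewrite /expsum /= !big_cons -/(expsum _ _) -/(expsum q y) -/(expsum _ _) /=.
set Q' := expsum _ _ in h1 *; set q' := expsum _ _ in h1 *; set G := expsum _ _ in h1 *.
set E1 := expR _ in h2 *; set E2 := expR _ in h2 *.
have -> : p.1 * E1 + Q' - (p.1 * E2 + q') - del * y * (p.1 * Phi p.2 * E2 + G) =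
  p.1 * (E1 - E2 - del * y * (Phi p.2 * E2)) + (Q' - q' - del * y * G) by ring.
apply: le_trans (ler_normD _ _) _; rewrite normrM.
have dy : 0 <= del * y by rewrite mulr_ge0// ltW.
have h3 : `|p.1| * `|E1 - E2 - del * y * (Phi p.2 * E2)| <= eps / 2 * (del * y).
  apply: (@le_trans _ _ (`|p.1| * (eps / 2 / (1 + `|p.1|) * (del * y)))).
    by rewrite ler_wpM2l.
  rewrite [leLHS]mulrA ler_wpM2r// mulrCA ler_piMr ?(ltW e20)// ler_pdivrMr// mul1r.
  by rewrite lerDr.
by move: h1 h3; lra.
Qed.

(** The mean of X on surviving paths tends to 0; this bound then puts the value at 0 in place of the
    value at X. *)
Lemma expsum_lipschitz q : positive_exponents q ->
  exists2 L, 0 <= L & forall y, 0 <= y -> expsum q 0 - L * y <= expsum q y.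
Proof.
elim: q => [|p q IH] /=.
  by exists 0 => // y y0; rewrite /expsum !big_nil mul0r subrr.
move=> /andP[p0 /IH[L L0 HL]].
exists (`|p.1| * p.2 + L); first by rewrite addr_ge0// mulr_ge0// ltW.
move=> y y0; have := HL y y0; rewrite /expsum !big_cons mulr0 oppr0 expR0 mulr1.
set s0 := \sum_(_ <- _) _; set s := \sum_(_ <- _) _ => h.
have py : 0 <= p.2 * y by rewrite mulr_ge0// ltW.
have e1 : expR (- (p.2 * y)) <= 1 by rewrite -expR0 ler_expR oppr_le0.
have e2 := expR_ge1Dx (- (p.2 * y)).
have k : p.1 * (1 - expR (- (p.2 * y))) <= `|p.1| * (p.2 * y).
  apply: (le_trans (ler_norm _)); rewrite normrM ler_wpM2l// ger0_norm ?subr_ge0//.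
  by move: e2; lra.
by move: k h; lra.
Qed.

End expsum_estimates.

(** * The mean of the process, and its transitions on exponential sums *)

Section cb_law.
Context {R : realType} {d : measure_display} {T : measurableType d}.
Variables (Phi : R -> R) (X : R -> {mfun T >-> R}) (P : R -> probability T R).
Hypotheses (tame : tame_mechanism Phi) (markov : markov_process X P).
Variable v : R -> R -> R.
Hypothesis vsol : forall l, 0 <= l -> cumulant_solution Phi l (v ^~ l).
Hypothesis laplace : forall x t l : R, 0 <= x -> 0 <= t -> 0 <= l ->
  ('E_(P x)[fun w => expR (- (l * X t w))])%E = (expR (- (x * v t l)))%:E.
Implicit Types (x t s r : R) (A : set T) (q : seq (R * R)).

Let X0 t w : 0 <= t -> 0 <= X t w.
Proof. by move=> t0; exact: markov_ge0 markov _ _ t0. Qed.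

Let v0 t l : 0 <= t -> 0 <= l -> 0 <= v t l.
Proof. by move=> t0 l0; case: (vsol _ l0) => _ + _ _; apply. Qed.

Lemma measurable_expX l t (A : set T) : measurable_fun A (fun w => expR (- (l * X t w))).
Proof.
exact/measurable_funTS/(measurableT_comp (measurable_expRN setT l)).
Qed.

Lemma expX_le1 l t w : 0 <= l -> 0 <= t -> `|expR (- (l * X t w))| <= 1.
Proof.
move=> l0 t0; rewrite ger0_norm ?expR_ge0// -expR0 ler_expR oppr_le0.
by rewrite mulr_ge0// X0.
Qed.

Lemma integrable_expX l t x A : 0 <= l -> 0 <= t -> measurable A ->
  (P x).-integrable A (EFin \o (fun w => expR (- (l * X t w)))).
Proof.
move=> l0 t0 mA; apply: (bounded_integrable_prob _ _ _ _ _ _ 1) => //.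
  exact: measurable_expX.
by move=> w _; exact: expX_le1.
Qed.

Lemma Rintegral_cst1 x : \int[P x]_w (1 : R) = 1.
Proof. by rewrite Rintegral_cst// mul1r; exact: (congr1 fine (probability_setT (P x))). Qed.

Lemma laplaceR x t l : 0 <= x -> 0 <= t -> 0 <= l ->
  \int[P x]_w expR (- (l * X t w)) = expR (- (x * v t l)).
Proof.
by move=> x0 t0 l0; have := laplace _ _ _ x0 t0 l0; rewrite unlock /Rintegral => ->.
Qed.

(** (1 - e^(-l X))/l increases to X as l decreases to 0 and has mean (1 - e^(-x v_t(l)))/l. From
    v_t(l) <= l comes E X_t <= x; from v_t(l) >= l - t Phi(l) and Phi(l) = o(l) comes the
    converse. *)
Lemma cb_mean x t : 0 <= x -> 0 <= t -> (\int[P x]_w (X t w)%:E = x%:E)%E.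
Proof.
move=> x0 t0.
pose ln (n : nat) : R := 2^-1 ^+ n.
have ln0 n : 0 < ln n by rewrite exprn_gt0// invr_gt0.
pose f l w : R := (1 - expR (- (l * X t w))) / l.
have f0 l w : 0 < l -> 0 <= f l w.
  move=> l0; rewrite divr_ge0 ?(ltW l0)// subr_ge0 -expR0 ler_expR oppr_le0.
  by rewrite mulr_ge0 ?X0// ltW.
have fX l w : 0 < l -> f l w <= X t w.
  move=> l0; rewrite ler_pdivrMr// [leRHS]mulrC; have := expR_ge1Dx (- (l * X t w)); lra.
have mf l : measurable_fun setT (EFin \o f l).
  by apply/measurable_EFinP/measurable_funM => //; apply: measurable_funB => //;
    exact: measurable_expX.
have Ef l : 0 < l -> (\int[P x]_w (f l w)%:E = ((1 - expR (- (x * v t l))) / l)%:E)%E.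
  move=> l0.
  have -> : (\int[P x]_w (f l w)%:E = \int[P x]_w (l^-1 * (1 - expR (- (l * X t w))))%:E)%E.
    by apply: eq_integral => w _; rewrite /f mulrC.
  have i1 : (P x).-integrable setT (EFin \o (fun w => 1 - expR (- (l * X t w)))).
    apply: integrable_subr => //; last by apply: integrable_expX => //; exact: ltW.
    exact: finite_measure_integrable_cst.
  rewrite -[LHS]fineK; last by apply: integrable_fin_num => //; exact: integrable_mulrl.
  rewrite -/(Rintegral _ _ _) RintegralZl// RintegralB//; last 2 first.
  - exact: finite_measure_integrable_cst.
  - by apply: integrable_expX => //; exact: ltW.
  by rewrite Rintegral_cst1 laplaceR ?(ltW l0)// mulrC.
have vl l : 0 < l -> v t l <= l.
  by move=> l0; exact: cumulant_le _ tame _ _ (vsol _ (ltW l0)) _ t0.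
have upper : (\int[P x]_w (X t w)%:E <= x%:E)%E.
  have lim_f w : (fun n => (f (ln n) w)%:E) @ \oo --> (X t w)%:E.
    apply: cvg_EFin; first exact: nearW.
    apply: (@squeeze_cvgr _ _ _ _ (fun n => X t w - ln n * X t w ^+ 2) (fun=> X t w)).
    - apply: nearW => n /=; rewrite fX// andbT ler_pdivlMr//.
      have := jump_exponent_le (ln n) (X t w) (ltW (ln0 n)) (X0 _ _ t0).
      by rewrite /jump_exponent expr2 !expr2; lra.
    - rewrite -[X in _ --> X]subr0; apply: cvgB; first exact: cvg_cst.
      rewrite -[X in _ --> X](mul0r (X t w ^+ 2)); apply: cvgMl.
      by apply: cvg_expr; rewrite ger0_norm ?invr_ge0// invf_lt1 ?ltr1n.
    - exact: cvg_cst.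
  rewrite (_ : (\int[P x]_w (X t w)%:E =
    \int[P x]_w limn (fun n => (f (ln n) w)%:E))%E); last first.
    by apply: eq_integral => w _; apply/esym/cvg_lim.
  have nd w : setT w -> {homo (fun n => (f (ln n) w)%:E) : m n / (m <= n)%N >-> (m <= n)%E}.
    move=> _; apply/nondecreasing_seqP => n; rewrite lee_fin /f.
    rewrite /ln exprS -/(ln n) invfM invrK.
    (* Halving l reduces the monotonicity to 1 - E^2 <= 2 (1 - E), a square. *)
    set E := expR (- (2^-1 * ln n * X t w)).
    have -> : expR (- (ln n * X t w)) = E * E.
      by rewrite -expRD; congr expR; field.
    rewrite [leRHS]mulrA ler_wpM2r ?invr_ge0 ?(ltW (ln0 n))//.
    have E0 := sqr_ge0 (1 - E); rewrite expr2 in E0; lra.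
  have fn0 n w : setT w -> (0 <= (f (ln n) w)%:E)%E by move=> _; rewrite lee_fin f0.
  have cv := cvg_monotone_convergence (mu := P x) measurableT (fun n => mf (ln n)) fn0 nd.
  rewrite -(cvg_lim _ cv)//; apply: lime_le; first exact: cvgP cv.
  apply: nearW => n; rewrite Ef// lee_fin ler_pdivrMr//.
  have := expR_ge1Dx (- (x * v t (ln n))).
  have : x * v t (ln n) <= x * ln n by rewrite ler_wpM2l// vl.
  by lra.
apply/eqP; rewrite eq_le upper/=.
have [xz|xp] := eqVneq x 0.
  by rewrite xz; apply: integral_ge0 => w _; rewrite lee_fin X0.
have {}xp : 0 < x by rewrite lt_def xp.
have fin : (\int[P x]_w (X t w)%:E)%E \is a fin_num.
  rewrite ge0_fin_numE; first exact: le_lt_trans upper (ltry _).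
  by apply: integral_ge0 => w _; rewrite lee_fin X0.
rewrite -(fineK fin) lee_fin; apply/ler_addgt0Pr => eps eps0.
have k0 : 0 < 1 + x * t by rewrite ltr_wpDr// mulr_ge0.
have [dl dl0 Hdl] := tame_small _ tame (eps / 2 / (1 + x * t))
  (divr_gt0 (divr_gt0 eps0 (ltr0n _ 2)) k0).
(* Both losses, x t Phi(l) and the quadratic term (x v_t(l))^2, are then at most l eps/2. *)
pose l := Num.min dl (eps / 2 / (1 + x ^+ 2)).
have x20 : 0 < 1 + x ^+ 2 by rewrite ltr_wpDr// sqr_ge0.
have l0 : 0 < l by rewrite lt_min dl0 !divr_gt0.
have ldl : l <= dl by rewrite ge_min lexx.
have leps : l * (1 + x ^+ 2) <= eps / 2 by rewrite -ler_pdivlMr// ge_min lexx orbT.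
have h1 : (((1 - expR (- (x * v t l))) / l)%:E <= (fine (\int[P x]_w (X t w)%:E))%:E)%E.
  rewrite fineK// -Ef//; apply: ge0_le_integral => //.
  - by move=> w _; rewrite lee_fin f0.
  - exact: mf.
  - exact/measurable_EFinP.
  - by move=> w _; rewrite lee_fin fX.
rewrite lee_fin ler_pdivrMr// in h1.
set I := fine _ in h1 *.
have vge := cumulant_ge _ tame _ _ (vsol _ (ltW l0)) _ t0.
have Phil := Hdl _ l0 ldl.
have vv0 := v0 _ _ t0 (ltW l0); have vvl := vl _ l0.
have h2 := jump_exponent_le (v t l) x vv0 x0.
rewrite /jump_exponent mulrC in h2.
have h3 : x * (t * Phi l) <= eps / 2 * l.
  apply: (@le_trans _ _ (x * (t * (eps / 2 / (1 + x * t) * l)))).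
    by rewrite !ler_wpM2l.
  rewrite (_ : x * (t * (eps / 2 / (1 + x * t) * l)) = 
    (eps / 2 * l) * ((x * t) / (1 + x * t))); last by ring.
  rewrite ler_piMr ?mulr_ge0 ?(ltW l0) ?divr_ge0 ?(ltW eps0)//.
  by rewrite ler_pdivrMr// mul1r lerDr.
have h4 : v t l ^+ 2 * x ^+ 2 <= eps / 2 * l.
  apply: (@le_trans _ _ (l * l * (1 + x ^+ 2))).
    rewrite expr2 ler_pM ?mulr_ge0 ?sqr_ge0 ?ler_pM//.
    by rewrite lerDr.
  by rewrite -mulrA mulrC ler_wpM2r// ltW.
have h5 : x * l - x * (t * Phi l) <= x * v t l by rewrite -mulrBr ler_wpM2l.
rewrite -(ler_pM2r l0) mulrDl.
by move: h1 h2 h3 h4 h5; lra.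
Qed.

Lemma integrableX x t A : 0 <= x -> 0 <= t -> measurable A ->
  (P x).-integrable A (EFin \o X t).
Proof.
move=> x0 t0 mA; apply: (@integrableS _ _ _ _ setT) => //.
apply/integrableP; split; first exact/measurable_EFinP.
rewrite (_ : (\int[P x]_w `|(EFin \o X t) w| = x%:E)%E) ?ltry//.
by rewrite -(cb_mean x t)//; apply: eq_integral => w _; rewrite /= ger0_norm// X0.
Qed.

Lemma integrable_expsumX q x t A : (forall p, p \in q -> 0 <= p.2) -> 0 <= t -> measurable A ->
  (P x).-integrable A (EFin \o (fun w => expsum q (X t w))) /\
  \int[P x]_(w in A) expsum q (X t w) =
    \sum_(p <- q) p.1 * \int[P x]_(w in A) expR (- (p.2 * X t w)).
Proof.
move=> q0 t0 mA; 
apply: (integrable_lincomb _ _ _ _ _ _ _ _ (fun p w => expR (- (p.2 * X t w)))) => //.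
by move=> p pq; apply: integrable_expX => //; exact: q0.
Qed.

Lemma markov_expX x s t l A : 0 <= x -> 0 <= s -> 0 <= t -> 0 <= l ->
  natural_filtration X t A ->
  \int[P x]_(w in A) expR (- (l * X (t + s) w)) =
    \int[P x]_(w in A) expR (- (v s l * X t w)).
Proof.
move=> x0 s0 t0 l0 FA; congr fine.
rewrite (markov_ge0_integral _ P x s t A (fun y => (expR (- (l * y)))%:E) markov)//; last 1 first.
- by apply/measurable_EFinP; exact: measurable_expRN.
apply: eq_integral => w _.
have := laplace (X t w) s l (X0 _ _ t0) s0 l0; rewrite unlock => ->.
by rewrite mulrC.
Qed.

Lemma markov_expsumX q x s t A : positive_exponents q ->
  0 <= x -> 0 <= s -> 0 <= t -> natural_filtration X t A ->
  \int[P x]_(w in A) expsum q (X (t + s) w) =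
    \int[P x]_(w in A) expsum (map_exponents (v s) q) (X t w).
Proof.
move=> q0 x0 s0 t0 FA; have mA := natural_filtration_measurable _ _ _ FA.
have q0' p : p \in q -> 0 <= p.2 by move=> pq; exact: ltW (allP q0 _ pq).
have q1 p : p \in map_exponents (v s) q -> 0 <= p.2.
  by move=> /mapP[p' p'q ->] /=; apply: v0 => //; exact: q0'.
rewrite (integrable_expsumX q _ _ _ q0' (addr_ge0 t0 s0) mA).2.
rewrite (integrable_expsumX _ _ _ _ q1 t0 mA).2 big_map.
by apply: eq_big_seq => p pq /=; rewrite markov_expX// q0'.
Qed.

End cb_law.

Lemma Rintegral_split (d : measure_display) (T : measurableType d) (R : realType)
    (mu : {measure set T -> \bar R}) (B B' : set T) (f : T -> R) :
  measurable B -> measurable B' -> B' `<=` B -> mu.-integrable B (EFin \o f) ->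
  \int[mu]_(w in B) f w = \int[mu]_(w in B') f w + \int[mu]_(w in B `\` B') f w.
Proof.
move=> mB mB' sub intf; have BE : B = B' `|` (B `\` B') by rewrite setDUK.
rewrite [in LHS]BE Rintegral_setU//; first exact: measurableD.
- by rewrite -BE.
- by rewrite disj_set2E setDE setIA setIAC setICr set0I.
Qed.

(** * Optional stopping along grids *)

Section optional_stopping.
Context {R : realType} {d : measure_display} {T : measurableType d}.
Variables (Phi : R -> R) (X : R -> {mfun T >-> R}) (P : R -> probability T R).
Hypotheses (tame : tame_mechanism Phi) (markov : markov_process X P).
Variable v : R -> R -> R.
Hypothesis vsol : forall l, 0 <= l -> cumulant_solution Phi l (v ^~ l).
Hypothesis laplace : forall x t l : R, 0 <= x -> 0 <= t -> 0 <= l ->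
  ('E_(P x)[fun w => expR (- (l * X t w))])%E = (expR (- (x * v t l)))%:E.
Variables (x t r : R) (A : set T).
Hypotheses (x0 : 0 <= x) (t0 : 0 <= t) (r0 : 0 <= r) (FA : natural_filtration X t A).
Implicit Types (q : seq (R * R)) (del : R) (n : nat).

(** The n-th set belongs to the filtration at its last grid time, as the next use of the Markov
    property requires; t itself is a grid time. *)
Fixpoint stay_below del n : set T :=
  (if n is m.+1 then stay_below del m else A) `&`
  X (t + n%:R * del) @^-1` `]-oo, r].

Section step.
Variable del : R.
Hypothesis del0 : 0 < del.

Let Y n := X (t + n%:R * del).

Let tn0 n : 0 <= t + n%:R * del.
Proof. by rewrite addr_ge0// mulr_ge0// ltW. Qed.

Lemma stay_below_filtration n : natural_filtration X (t + n%:R * del) (stay_below del n).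
Proof.
elim: n => [|n IH]; apply: natural_filtrationI;
    try by apply: natural_filtration_preimage.
  by rewrite mul0r addr0.
by apply: natural_filtration_nd IH; rewrite lerD2l ler_wpM2r ?(ltW del0)// ler_nat.
Qed.

Let mB n : measurable (stay_below del n).
Proof. exact: natural_filtration_measurable (stay_below_filtration n). Qed.

Lemma stay_below_sub n : stay_below del n.+1 `<=` stay_below del n.
Proof. by move=> w []. Qed.

Lemma stay_below_le n w : stay_below del n w -> 0 <= Y n w <= r.
Proof.
move=> Bw; have Yr : Y n w <= r by case: n Bw => [|n] []; rewrite /= in_itv.
by rewrite Yr andbT; exact: markov_ge0 markov _ _ (tn0 n).
Qed.

Let m n := \int[P x]_(w in stay_below del n) (1 : R).
Let a q n := \int[P x]_(w in stay_below del n) expsum q (Y n w).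
(** The term that the factor y of the generator produces at step n. *)
Let e n := \int[P x]_(w in stay_below del n) Y n w.

Let integrable1 B : measurable B -> (P x).-integrable B (EFin \o cst 1).
Proof. by move=> mB'; exact: finite_measure_integrable_cst. Qed.

Let integrableY n B : measurable B -> (P x).-integrable B (EFin \o Y n).
Proof. exact: (integrableX _ _ _ tame markov _ vsol laplace _ _ _ x0 (tn0 n)). Qed.

Let integrableqY q n B : (forall p, p \in q -> 0 <= p.2) -> measurable B ->
  (P x).-integrable B (EFin \o (fun w => expsum q (Y n w))).
Proof. by move=> q0 mB'; have [] := integrable_expsumX _ _ markov q x _ _ q0 (tn0 n) mB'. Qed.

Let mE n : m n = fine (P x (stay_below del n)).
Proof. by rewrite /m Rintegral_cst// mul1r. Qed.

Let m1 n : 0 <= m n <= 1.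
Proof.
rewrite mE; apply/andP; split; first exact: fine_ge0.
by rewrite -lee_fin fineK ?fin_num_measure//; exact: probability_le1.
Qed.

(* One step of optional stopping for the chain X_(t + n del), stopped when it
   exceeds r: the generator acts on paths that stay, eps pays for those that leave. *)
Lemma stay_below_step q eps C n : positive_exponents q -> 0 <= eps ->
  (forall y, r < y -> - eps <= expsum q y) ->
  (forall y, 0 <= y -> y <= r ->
     expsum (map_exponents (v del) q) y - expsum q y <= C * y) ->
  a q n.+1 <= a q n + C * e n + eps * (m n - m n.+1).
Proof.
move=> q0 eps0 qr gen.
have q0' p : p \in q -> 0 <= p.2 by move=> pq; exact: ltW (allP q0 _ pq).
have q1 p : p \in map_exponents (v del) q -> 0 <= p.2.
  move=> /mapP[p' p'q ->] /=; case: (vsol _ (q0' _ p'q)) => _ + _ _; apply.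
  exact: ltW.
have sub := @stay_below_sub n.
have iqn1 := integrableqY q n.+1 _ q0' (mB n).
have split_q := Rintegral_split _ _ _ _ _ _ _ (mB n) (mB n.+1) sub iqn1.
have split_1 := Rintegral_split _ _ _ _ _ _ _ (mB n) (mB n.+1) sub (integrable1 _ (mB n)).
have mD : measurable (stay_below del n `\` stay_below del n.+1) by exact: measurableD.
have low : - eps * \int[P x]_(w in stay_below del n `\` stay_below del n.+1) (1 : R) <=
    \int[P x]_(w in stay_below del n `\` stay_below del n.+1) expsum q (Y n.+1 w).
  rewrite -RintegralZl//; last exact: integrable1.
  apply: le_Rintegral => //.
  - by apply: integrable_mulrl => //; exact: integrable1.
  - exact: integrableqY.
  move=> w [Bw nB]; rewrite mulr1; apply: qr; rewrite ltNge; apply/negP => Yr.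
  by apply: nB; split => //=; rewrite in_itv.
have mark : \int[P x]_(w in stay_below del n) expsum q (Y n.+1 w) =
    \int[P x]_(w in stay_below del n) expsum (map_exponents (v del) q) (Y n w).
  have := markov_expsumX _ _ _ markov _ vsol laplace q x del _ _ q0 x0 (ltW del0) (tn0 n)
    (stay_below_filtration n).
  by rewrite /Y -natr1 mulrDl mul1r addrA.
have up : \int[P x]_(w in stay_below del n) expsum (map_exponents (v del) q) (Y n w) <=
    a q n + C * e n.
  rewrite /a /e -RintegralZl//; last exact: integrableY.
  rewrite -RintegralD//; [|exact: integrableqY|
    by apply: integrable_mulrl => //; exact: integrableY].
  apply: le_Rintegral => //; first exact: integrableqY.
    have i1 := integrableqY q n _ q0' (mB n).
    have i2 := integrable_mulrl _ _ _ _ _ _ C (mB n) (integrableY n _ (mB n)).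
    by have := integrableD (mB n) i1 i2.
  move=> w /stay_below_le/andP[Y0 Yr]; rewrite addrC -lerBlDr; exact: gen.
move: split_q split_1 low up; rewrite mark -/(a q n.+1) -/(m n) -/(m n.+1).
by move=> -> ->; lra.
Qed.

(** The exit costs telescope to eps (m 0 - m n), at most eps however many steps are made. *)
Lemma stay_below_iter q eps C n : positive_exponents q -> 0 <= eps ->
  (forall y, r < y -> - eps <= expsum q y) ->
  (forall y, 0 <= y -> y <= r ->
     expsum (map_exponents (v del) q) y - expsum q y <= C * y) ->
  a q n <= a q 0%N + C * (\sum_(0 <= k < n) e k) + eps.
Proof.
move=> q0 eps0 qr gen.
suff : a q n <= a q 0%N + C * (\sum_(0 <= k < n) e k) + eps * (m 0%N - m n).
  move=> /le_trans; apply; rewrite lerD2l ler_piMr//.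
  by have /andP[_ +] := m1 0%N; have /andP[+ _] := m1 n; lra.
elim: n => [|n IH]; first by rewrite big_geq// mulr0 subrr mulr0 !addr0.
rewrite big_nat_recr//= mulrDr.
by have := stay_below_step _ _ _ n q0 eps0 qr gen; lra.
Qed.

(* Optional stopping applied to - e^(-l y). *)
Lemma stay_below_occupation n l : 0 < l ->
  (l - v del l) * expR (- (l * r)) * (\sum_(0 <= k < n) e k) <= 2.
Proof.
move=> l0; pose q := [:: (-1 : R, l)].
have qE y : expsum q y = - expR (- (l * y)) by rewrite /expsum big_seq1 mulN1r.
have q0 : positive_exponents q by rewrite /positive_exponents /= l0.
have vl := cumulant_le _ tame _ _ (vsol _ (ltW l0)) _ (ltW del0).
have v0 : 0 <= v del l by case: (vsol _ (ltW l0)) => _ + _ _; apply; exact: ltW.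
have E1 y : 0 <= y -> expR (- (l * y)) <= 1.
  by move=> y0; rewrite -expR0 ler_expR oppr_le0 mulr_ge0// ltW.
(* On [0, r] the drift is at most -(l - v) e^(-l r) y, since e^(-l y) >= e^(-l r). The final 1 is
   the exit cost, as -e^(-l y) >= -1; together with -1 <= [a q n] it makes up the bound 2. *)
have : a q n <= a q 0%N +
    - ((l - v del l) * expR (- (l * r))) * (\sum_(0 <= k < n) e k) + 1.
  apply: stay_below_iter => // [y ry|y y0 yr].
    by rewrite qE lerN2 E1// (le_trans r0)// ltW.
  rewrite expsum_map_exponents big_seq1 qE mulN1r mulNr.
  have /andP[g1 _] := exp_increment_bound _ _ _ vl v0 y0.
  have : expR (- (l * r)) <= expR (- (l * y)) by rewrite ler_expR lerN2 ler_wpM2l// ltW.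
  have : 0 <= (l - v del l) * y by rewrite mulr_ge0// subr_ge0.
  move: g1; set z := (l - v del l) * y => g1 z0 EE.
  have : z * expR (- (l * r)) <= z * expR (- (l * y)) by rewrite ler_wpM2l.
  have -> : (l - v del l) * expR (- (l * r)) * y = z * expR (- (l * r)) by rewrite /z; ring.
  by lra.
have an : - 1 <= a q n.
  apply: (@le_trans _ _ (- 1 * m n)); first by have /andP[_] := m1 n; lra.
  rewrite /m -RintegralZl//; last exact: integrable1.
  apply: le_Rintegral => //.
  - by apply: integrable_mulrl => //; exact: integrable1.
  - by apply: integrableqY => // p; rewrite inE => /eqP -> /=; exact: ltW.
  - by move=> w /stay_below_le/andP[Y0 _]; rewrite mulr1 qE lerN2 E1.
have a0 : a q 0%N <= 0.
  rewrite -(mul0r (fine (P x (stay_below del 0)))) -Rintegral_cst//.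
  apply: le_Rintegral => //.
  - by apply: integrableqY => // p; rewrite inE => /eqP -> /=; exact: ltW.
  - exact: finite_measure_integrable_cst.
  - by move=> w _; rewrite qE oppr_le0 expR_ge0.
by lra.
Qed.

(** Bounded occupation sums force [e] to 0, so on survivors q(X) may be replaced by q(0) in the
    limit. The same bound pays for the drift error [C] of all steps at once. *)
Lemma stay_below_limit q eps C l : 0 < l -> v del l < l ->
  positive_exponents q -> 0 <= eps -> 0 <= C ->
  (forall y, r < y -> - eps <= expsum q y) ->
  (forall y, 0 <= y -> y <= r ->
     expsum (map_exponents (v del) q) y - expsum q y <= C * y) ->
  expsum q 0 * fine (P x (\bigcap_n stay_below del n)) <=
    \int[P x]_(w in stay_below del 0) expsum q (Y 0 w) +
    C * (2 / ((l - v del l) * expR (- (l * r)))) + eps.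
Proof.
move=> l0 vl q0 eps0 C0 qr gen.
pose k := (l - v del l) * expR (- (l * r)).
have k0 : 0 < k by rewrite mulr_gt0 ?expR_gt0// subr_gt0.
have e0 n : 0 <= e n by apply: Rintegral_ge0 => w /stay_below_le/andP[].
have Sn n : \sum_(0 <= i < n) e i <= 2 / k.
  by rewrite ler_pdivlMr// mulrC; exact: stay_below_occupation.
have e_cvg0 : e @ \oo --> 0.
  apply: cvg_series_cvg_0; apply: nondecreasing_is_cvgn.
    by apply/nondecreasing_seqP => n; rewrite /series/= big_nat_recr//= lerDl.
  by exists (2 / k) => _ [n _ <-]; exact: Sn.
have m_cvg : m @ \oo --> fine (P x (\bigcap_n stay_below del n)).
  have -> : m = fine \o (P x \o stay_below del) by apply/funext => n; rewrite mE.
  apply: fine_cvg; rewrite fineK; last first.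
    by apply: fin_num_measure; exact: bigcapT_measurable.
  apply: nonincreasing_cvg_mu => //.
  - by rewrite (le_lt_trans (probability_le1 _ _))// ltry.
  - exact: bigcapT_measurable.
  - by apply/nonincreasing_seqP => n; apply/subsetPset; exact: stay_below_sub.
have [L L0 HL] := expsum_lipschitz _ q0.
have lim_cvg : (fun n => expsum q 0 * m n - L * e n) @ \oo -->
    expsum q 0 * fine (P x (\bigcap_n stay_below del n)).
  rewrite -[X in _ --> X]subr0; apply: cvgB; first by apply: cvgMr.
  by rewrite -[X in _ --> X](mulr0 L); apply: cvgMr.
rewrite -(cvg_lim _ lim_cvg)//; apply: limr_le; first exact: cvgP lim_cvg.
apply: nearW => n.
have q0' p : p \in q -> 0 <= p.2 by move=> pq; exact: ltW (allP q0 _ pq).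
apply: (@le_trans _ _ (a q n)).
  rewrite /m /e -!RintegralZl//; last 2 first.
  - exact: integrableY.
  - exact: integrable1.
  rewrite -RintegralB//; last 2 first.
  - by apply: integrable_mulrl => //; exact: integrable1.
  - by apply: integrable_mulrl => //; exact: integrableY.
  apply: le_Rintegral => //.
  - apply: integrable_subr => //; apply: integrable_mulrl => //; first exact: integrable1.
    exact: integrableY.
  - exact: integrableqY.
  - by move=> w /stay_below_le/andP[Y0 _]; rewrite mulr1 HL.
apply: (le_trans (stay_below_iter _ _ _ n q0 eps0 qr gen)).
by rewrite lerD2r lerD2l ler_wpM2l.
Qed.

Lemma stay_below_bigcapE :
  \bigcap_n stay_below del n = [set w | A w /\ forall n, X (t + n%:R * del) w <= r].
Proof.
apply/seteqP; split => w /=.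
  move=> Bw; split; first by case: (Bw 0%N Logic.I).
  by move=> n; have /andP[] := stay_below_le _ _ (Bw n Logic.I).
by move=> [Aw Xr] n _; elim: n => [|n IH]; split => //=; rewrite in_itv /=.
Qed.

End step.

Definition stay_below_forever : set T := [set w | A w /\ forall s, t <= s -> X s w <= r].

Hypothesis Xrcll : forall w, rcll (fun s => X s w).

Let dy j : R := 2^-1 ^+ j.
Let dy0 j : 0 < dy j. Proof. by rewrite exprn_gt0// invr_gt0. Qed.
Let G j := \bigcap_n stay_below (dy j) n.

Let dy_cvg0 : dy @ \oo --> 0.
Proof. by apply: cvg_expr; rewrite ger0_norm ?invr_ge0// invf_lt1 ?ltr1n. Qed.

Let mG j : measurable (G j).
Proof.
apply: bigcapT_measurable => n.
exact: natural_filtration_measurable (stay_below_filtration (dy j) (dy0 j) n).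
Qed.

(** By right continuity a path above r at time s remains there on an interval to the right of s, and
    fine dyadic grids meet that interval. *)
Lemma stay_below_foreverE : stay_below_forever = \bigcap_j G j.
Proof.
apply/seteqP; split => w /=.
  move=> [Aw Xr] j _; rewrite /G stay_below_bigcapE//; split => // n.
  by apply: Xr; rewrite lerDl mulr_ge0// ltW.
move=> Gw; have Gw' j : A w /\ forall n, X (t + n%:R * dy j) w <= r.
  by have := Gw j Logic.I; rewrite /G stay_below_bigcapE.
split => [|s ts]; first by case: (Gw' 0%N).
rewrite leNgt; apply/negP => rX.
have [rc _] := Xrcll w.
have : \forall u \near s^'+, r < X u w.
  by have := rc s (le_trans t0 ts) => /cvgr_gt; apply.
rewrite /at_right near_withinE => /nbhs_ballP[ep /= ep0 Hep].
have [j _ /(_ j (leqnn j))] := (cvgr_lt _ dy_cvg0 ep) ep0.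
rewrite /= => dyj.
(* The first grid time strictly after s: the right neighbourhood excludes s. *)
pose n := (Num.trunc ((s - t) / dy j)).+1.
have st0 : 0 <= (s - t) / dy j by rewrite divr_ge0 ?subr_ge0// ltW.
have n1 : (s - t) / dy j < n%:R by rewrite /n; exact: truncnS_gt.
have n2 : n%:R <= (s - t) / dy j + 1.
  by rewrite /n -natr1 lerD2r; have /andP[] := truncn_itv st0.
rewrite ltr_pdivrMr// in n1.
have n2' : n%:R * dy j <= s - t + dy j.
  have := ler_wpM2r (ltW (dy0 j)) n2; rewrite mulrDl mul1r divfK//.
  by rewrite gt_eqF.
have := Hep (t + n%:R * dy j); rewrite /ball/= => /(_ _ _)/wrap[].
- by rewrite ltr_norml; apply/andP; split; lra.
- by lra.
by case: (Gw' j) => _ /(_ n); rewrite leNgt => /negP.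
Qed.

Lemma measurable_stay_below_forever : measurable stay_below_forever.
Proof. by rewrite stay_below_foreverE; exact: bigcapT_measurable. Qed.

Let G_cvg : (fun j => fine (P x (G j))) @ \oo --> fine (P x stay_below_forever).
Proof.
apply: fine_cvg; rewrite fineK; last first.
  by apply: fin_num_measure; exact: measurable_stay_below_forever.
rewrite stay_below_foreverE; apply: nonincreasing_cvg_mu => //.
- by rewrite (le_lt_trans (probability_le1 _ _))// ltry.
- exact: bigcapT_measurable.
- apply/nonincreasing_seqP => j; apply/subsetPset => w.
  rewrite /G !stay_below_bigcapE// => -[Aw Xr]; split => // n.
  (* Dyadic grids nest: time n of grid j is time 2n of grid j + 1. *)
  have := Xr (n * 2)%N; rewrite natrM /dy exprS.
  by rewrite -mulrA (mulrA 2%:R) divff ?mul1r// pnatr_eq0.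
Qed.

(** A nearly superharmonic [h] decreases on average until the exit from [0, r]; exits contribute at
    least 0 and survivors end at 0. [h] acts pointwise, through its exponential approximations,
    while [H] is the majorant to be integrated. *)
Lemma stay_below_forever_le (h H : R -> R) :
  (forall eps, 0 < eps -> exists q, [/\ positive_exponents q,
     forall y, 0 <= y -> `|h y - expsum q y| <= eps &
     forall y, 0 <= y -> y <= r -> expsum (scale_coef Phi q) y <= eps]) ->
  (forall y, r < y -> 0 <= h y) ->
  (forall y, 0 <= y -> y <= r -> h y <= H y) ->
  (P x).-integrable (A `&` X t @^-1` `]-oo, r]) (EFin \o (fun w => H (X t w))) ->
  h 0 * fine (P x stay_below_forever) <=
    \int[P x]_(w in A `&` X t @^-1` `]-oo, r]) H (X t w).
Proof.
move=> happ hr hH iH.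
set I := \int[P x]_(w in _) _.
set M := fine _.
have M01 : 0 <= M <= 1.
  apply/andP; split; first exact: fine_ge0.
  have mS := measurable_stay_below_forever.
  by rewrite -lee_fin fineK ?fin_num_measure//; exact: probability_le1.
have [l l0 Phil] := tame_pos _ tame.
(* The drift constant 2 eps del times the occupation bound 2/((l - v) e^(-l r)), where l - v >= del
   Phi(l)/2, is at most 8 eps e^(l r)/Phi(l): the mesh cancels. The other three eps come from h(0),
   from [H] and from the exit cost. *)
pose K := 3 + 8 * expR (l * r) / Phi l.
have K0 : 0 < K by rewrite ltr_pwDl// divr_ge0 ?mulr_ge0 ?expR_ge0// ltW.
apply/ler_addgt0Pr => eps' eps'0.
pose eps := eps' / K; have eps0 : 0 < eps by rewrite divr_gt0.
have [q [q0 hq gq]] := happ _ eps0.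
have q0' p : p \in q -> 0 <= p.2 by move=> pq; exact: ltW (allP q0 _ pq).
have [d1 d10 Hd1] := expsum_generator_error _ tame _ vsol _ _ _ q0 r0 eps0.
have [d2 d20 Hd2] := tame_left_cont _ tame l (Phi l / 2) l0 (divr_gt0 Phil (ltr0n _ 2)).
have bound j : dy j <= d1 -> dy j * Phi l <= d2 -> dy j * Phi l <= l ->
    expsum q 0 * fine (P x (G j)) <= I + eps + eps * (8 * expR (l * r) / Phi l) + eps.
  move=> jd1 jd2 jl.
  have dPhi : dy j * (Phi l / 2) <= l - v (dy j) l.
    apply: le_trans (cumulant_decrease _ tame _ _ (ltW l0) (vsol _ (ltW l0)) _ (ltW (dy0 j)) _);
      last by rewrite subr_ge0.
    rewrite ler_wpM2l ?(ltW (dy0 j))//.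
    have := Hd2 (l - dy j * Phi l); rewrite subr_ge0 => /(_ jl).
    rewrite lerD2l lerN2 => /(_ jd2); rewrite gerBl mulr_ge0 ?(ltW Phil) ?(ltW (dy0 j))//.
    by move=> /(_ isT); lra.
  have vl : v (dy j) l < l.
    by rewrite -subr_gt0 (lt_le_trans _ dPhi)// mulr_gt0// divr_gt0.
  (* One eps for the generator of [q], one for its difference quotient. *)
  have eps2 : 0 <= 2 * eps * dy j.
    by apply: mulr_ge0; [apply: mulr_ge0 => //|]; exact: ltW.
  have := stay_below_limit (dy j) (dy0 j) q eps (2 * eps * dy j) l l0 vl q0 (ltW eps0) eps2.
  move=> /(_ _ _)/wrap[].
  - move=> y ry; have := hr _ ry; have := hq y (le_trans r0 (ltW ry)).
    by rewrite ler_distl => /andP[]; lra.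
  - move=> y y0 yr; have := Hd1 _ (dy0 j) jd1 y y0 yr.
    have dyy : 0 <= dy j * y by rewrite mulr_ge0// ltW.
    have := ler_wpM2l dyy (gq y y0 yr).
    by rewrite ler_distl => + /andP[_ +]; lra.
  move=> /le_trans; apply.
  rewrite lerD2r; apply: lerD.
    have -> : stay_below (dy j) 0 = A `&` X t @^-1` `]-oo, r].
      by rewrite /stay_below mul0r addr0.
    rewrite mul0r addr0.
    have mA0 : measurable (A `&` X t @^-1` `]-oo, r]).
      apply: measurableI; first exact: natural_filtration_measurable FA.
      by rewrite -[X in measurable X]setTI; exact: measurable_funPT.
    apply: (@le_trans _ _ (\int[P x]_(w in A `&` X t @^-1` `]-oo, r]) (H (X t w) + eps))).
      apply: le_Rintegral => //.
      - by have [] := integrable_expsumX _ _ markov q x t _ q0' t0 mA0.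
      - have ie : (P x).-integrable (A `&` X t @^-1` `]-oo, r]) (EFin \o cst eps).
          exact: finite_measure_integrable_cst.
        by have := integrableD mA0 iH ie.
      - move=> w [_]; rewrite /= in_itv/= => Xr.
        have X0 : 0 <= X t w by exact: markov_ge0 markov _ _ t0.
        have := hH _ X0 Xr; have := hq _ X0; rewrite ler_distl => /andP[].
        by lra.
    rewrite RintegralD//; last exact: finite_measure_integrable_cst.
    rewrite lerD2l Rintegral_cst// ler_piMr ?(ltW eps0)//.
    by rewrite -lee_fin fineK ?fin_num_measure//; exact: probability_le1.
  have E1 : expR (l * r) * expR (- (l * r)) = 1 by rewrite expRN divff// expR_eq0.
  rewrite mulrA ler_pdivrMr ?mulr_gt0 ?expR_gt0 ?subr_gt0//.
  apply: (@le_trans _ _ (eps * (8 * expR (l * r) / Phi l) *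
      (dy j * (Phi l / 2) * expR (- (l * r))))).
    rewrite (_ : eps * _ * _ = eps * dy j * 4 * (expR (l * r) * expR (- (l * r)))).
      by rewrite E1 mulr1 -!mulrA; lra.
    by field; rewrite gt_eqF.
  rewrite ler_wpM2l ?ler_wpM2r ?expR_ge0//.
  by rewrite mulr_ge0 ?(ltW eps0)// divr_ge0 ?(ltW Phil)// mulr_ge0// expR_ge0.
have lim_le : expsum q 0 * M <= I + eps + eps * (8 * expR (l * r) / Phi l) + eps.
  have cv : (fun j => expsum q 0 * fine (P x (G j))) @ \oo --> expsum q 0 * M.
    exact: cvgMr.
  rewrite -(cvg_lim _ cv)//; apply: limr_le; first exact: cvgP cv.
  have small (z : R) : 0 < z -> \forall j \near \oo, dy j <= z.
    by move=> z0; exact: cvgr_le dy_cvg0 _ z0.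
  near=> j; apply: bound.
  - by near: j; exact: small.
  - by rewrite -ler_pdivlMr//; near: j; apply: small; rewrite divr_gt0.
  - by rewrite -ler_pdivlMr//; near: j; apply: small; rewrite divr_gt0.
have hq0 : h 0 <= expsum q 0 + eps.
  by have := hq 0 (lexx 0); rewrite ler_distl => /andP[_].
have [M0 M1] := andP M01.
have : h 0 * M <= (expsum q 0 + eps) * M by rewrite ler_wpM2r.
have : eps * M <= eps by rewrite ler_piMr// ltW.
have : eps' = eps * K by rewrite /eps divfK// gt_eqF.
rewrite /K mulrDl mulrDr; lra.
Unshelve. all: by end_near. Qed.

End optional_stopping.

(** * First-order behaviour of the barrier profile *)

Section powR_limit.
Context {R : realType}.
Implicit Types a y s : R.

Lemma cvgr_inv_pinfty : (s^-1 : R) @[s --> +oo] --> (0 : R).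
Proof.
apply/cvgrPdist_le => e e0; near=> s.
have s0 : 0 < s by near: s; exact: nbhs_pinfty_gt.
have es : e^-1 <= s by near: s; apply: nbhs_pinfty_ge; exact: num_real.
by rewrite sub0r normrN ger0_norm ?invr_ge0 ?(ltW s0)// invf_ple ?posrE.
Unshelve. all: by end_near. Qed.

Definition defect a s y : R := s * (1 - Num.max 0 (1 - y / s) `^ a).

(** As a <= 1, b <= b^a on [0, 1], hence 1 - b^a <= 1 - b <= y/s. The bound y, taken at X_t, serves
    for dominated convergence. *)
Lemma defect_bounds a s y : 0 < a -> a <= 1 -> 0 < s -> 0 <= y -> 0 <= defect a s y <= y.
Proof.
move=> a0 a1 s0 y0; rewrite /defect.
have ys : 0 <= y / s by rewrite divr_ge0// ltW.
set b := Num.max 0 (1 - y / s).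
have b0 : 0 <= b by rewrite le_max lexx.
have b1 : b <= 1 by rewrite ge_max ler01 gerBl.
have bb : 1 - y / s <= b by rewrite le_max lexx orbT.
have ba : b <= b `^ a.
  move: b0; rewrite le_eqVlt => /predU1P[<-|b0]; first by rewrite powR_ge0.
  by rewrite ger1_powR// b0.
have ba1 : b `^ a <= 1.
  by have := ge0_ler_powR (ltW a0) b0 (ler01 : 1 \in Num.nneg) b1; rewrite powR1.
rewrite mulr_ge0 ?(ltW s0) ?subr_ge0//=.
by rewrite mulrC -ler_pdivlMr//; lra.
Qed.

(** With z = y/s, (1 - z)^a lies between e^(-a z/(1 - z)) and e^(-a z), both from 1 + u <= e^u, and
    these have the same slope at z = 0. *)
Lemma defect_cvg a y : 0 < a -> a <= 1 -> 0 <= y -> defect a s y @[s --> +oo] --> a * y.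
Proof.
move=> a0 a1 y0.
have inv0 : (s^-1 : R) @[s --> +oo] --> (0 : R) := cvgr_inv_pinfty.
apply: (@squeeze_cvgr _ _ _ _ (fun s => a * y - (a * y) ^+ 2 * s^-1)
  (fun s => a * y * (1 - y * s^-1)^-1)).
- near=> s; have s0 : 0 < s by near: s; exact: nbhs_pinfty_gt.
  have ys : y < s by near: s; apply: nbhs_pinfty_gt; exact: num_real.
  rewrite /defect; set z := y / s.
  have z0 : 0 <= z by rewrite divr_ge0// ltW.
  have z1 : z < 1 by rewrite ltr_pdivrMr// mul1r.
  have yE : y = z * s by rewrite divfK// gt_eqF.
  have z10 : 0 < 1 - z by rewrite subr_gt0.
  rewrite (max_idPr (ltW z10)).
  have up : (1 - z) `^ a <= expR (- (a * z)).
    rewrite (_ : expR (- (a * z)) = expR (- z) `^ a); last by rewrite -expRM; congr expR; ring.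
    apply: ge0_ler_powR; rewrite ?(ltW a0) ?nnegrE ?expR_ge0 ?(ltW z10)//.
    exact: expR_ge1Dx.
  have lo : expR (- (a * (z / (1 - z)))) <= (1 - z) `^ a.
    rewrite (_ : expR _ = expR (- (z / (1 - z))) `^ a); last by rewrite -expRM; congr expR; ring.
    apply: ge0_ler_powR; rewrite ?(ltW a0) ?nnegrE ?expR_ge0 ?(ltW z10)//.
    rewrite expRN -[leRHS]invrK lef_pV2 ?posrE ?expR_gt0 ?invr_gt0//.
    apply: le_trans (expR_ge1Dx _); rewrite le_eqVlt; apply/orP; left; apply/eqP.
    by field; rewrite gt_eqF.
  have e1 := jump_exponent_le 1 (a * z) ler01 (mulr_ge0 (ltW a0) z0).
  rewrite /jump_exponent !mul1r expr1n mul1r in e1.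
  have e2 := expR_ge1Dx (- (a * (z / (1 - z)))).
  apply/andP; split.
    rewrite (_ : a * y - _ = s * (a * z - (a * z) ^+ 2)); last first.
      by rewrite yE; field; rewrite gt_eqF.
    by rewrite ler_wpM2l ?(ltW s0)//; lra.
  rewrite -/z (_ : a * y * (1 - z)^-1 = s * (a * (z / (1 - z)))); last by rewrite [in LHS]yE; ring.
  by rewrite ler_wpM2l ?(ltW s0)//; lra.
- rewrite -[X in _ --> X]subr0; apply: cvgB; first exact: cvg_cst.
  by rewrite -[X in _ --> X](mulr0 ((a * y) ^+ 2)); apply: cvgMr.
- rewrite -[X in _ --> X]mulr1; apply: cvgMr.
  rewrite -[X in _ --> X]invr1; apply: cvgV; first exact: oner_neq0.
  rewrite -[X in _ --> X]subr0; apply: cvgB; first exact: cvg_cst.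
  by rewrite -[X in _ --> X](mulr0 y); apply: cvgMr.
Unshelve. all: by end_near. Qed.

End powR_limit.

(** * Asymptotics of the probability of exceeding r after time t *)

Section asymptotics.
Context {R : realType} {d : measure_display} {T : measurableType d}.
Variables (Phi : R -> R) (X : R -> {mfun T >-> R}) (P : R -> probability T R).
Hypotheses (tame : tame_mechanism Phi) (markov : markov_process X P).
Variable v : R -> R -> R.
Hypothesis vsol : forall l, 0 <= l -> cumulant_solution Phi l (v ^~ l).
Hypothesis laplace : forall x t l : R, 0 <= x -> 0 <= t -> 0 <= l ->
  ('E_(P x)[fun w => expR (- (l * X t w))])%E = (expR (- (x * v t l)))%:E.
Hypothesis Xrcll : forall w, rcll (fun s => X s w).
Variables (a M : R).
Hypotheses (a0 : 0 < a) (a1 : a <= 1) (M0 : 0 <= M).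
Hypothesis barrier : barrier_property Phi a M.
Variable x : R.
Hypothesis x0 : 0 <= x.

Section fixed_time.
Variables (t : R) (A : set T).
Hypotheses (t0 : 0 <= t) (FA : natural_filtration X t A).

Let X0 w : 0 <= X t w. Proof. exact: markov_ge0 markov _ _ t0. Qed.
Let mA : measurable A. Proof. exact: natural_filtration_measurable FA. Qed.

Let W s := \int[P x]_(w in A) Num.max 0 (1 - X t w / s) `^ a.

Let g s w : R := Num.max 0 (1 - X t w / s) `^ a.

Let g01 s w : 0 < s -> 0 <= g s w <= 1.
Proof.
move=> s0; rewrite powR_ge0/=.
have b0 : 0 <= Num.max 0 (1 - X t w / s) by rewrite le_max lexx.
have b1 : Num.max 0 (1 - X t w / s) <= 1.
  by rewrite ge_max ler01 gerBl divr_ge0// ltW.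
by have := ge0_ler_powR (ltW a0) b0 (ler01 : 1 \in Num.nneg) b1; rewrite powR1.
Qed.

Let mg s B : measurable_fun B (g s).
Proof.
apply/measurable_funTS/(measurableT_comp (measurable_powR _)).
apply: measurable_maxr => //; apply: measurable_funB => //.
exact: measurable_funM.
Qed.

Let ig s B : 0 < s -> measurable B -> (P x).-integrable B (EFin \o g s).
Proof.
move=> s0 mB; apply: (bounded_integrable_prob _ _ _ _ _ _ 1) => // w _.
by have /andP[g0 g1] := g01 s w s0; rewrite ger0_norm.
Qed.

Let mXr r : measurable (A `&` X t @^-1` `]-oo, r]).
Proof.
apply: measurableI => //.
by rewrite -[X in measurable X]setTI; exact: measurable_funPT.
Qed.

(** With c = r the barrier vanishes above r, so -h is nonnegative there; it is nearly superharmonic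
    because h is nearly subharmonic everywhere. *)
Lemma stay_below_forever_ge r : 1 < r ->
  W (r - 1) <= fine (P x (stay_below_forever X t r A)).
Proof.
move=> r1; have b0 : 0 < r - 1 by rewrite subr_gt0.
have r0 : 0 < r by exact: lt_trans r1.
have [|h [h0 hlo hhi happ]] := barrier (r - 1) r b0; first by rewrite gtrBl.
have qN q : expsum (scale_coef (fun=> -1) q) = \- expsum q.
  apply/funext => y; rewrite expsum_scale /= -sumrN; apply: eq_bigr => p _.
  by rewrite mulrN1 mulNr.
have := stay_below_forever_le _ _ _ tame markov _ vsol laplace x t r A x0 t0 (ltW r0) FA
  Xrcll (fun y => - h y) (fun y => - h 0 * Num.max 0 (1 - y / (r - 1)) `^ a).
move=> /(_ _ _ _ _)/wrap[].
- move=> eps eps0; have [q [q0 qh qlo _]] := happ _ eps0.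
  exists (scale_coef (fun=> -1) q); split; first by rewrite positive_exponents_scale.
    by move=> y y0; rewrite qN -opprD normrN qh.
  move=> y y0 yr; rewrite expsum_scale big_map /=.
  have := qlo y y0; rewrite expsum_scale => /(le_trans _) h'.
  rewrite (_ : \sum_(_ <- _) _ = - \sum_(p <- q) p.1 * Phi p.2 * expR (- (p.2 * y))).
    by rewrite lerNl; exact: h'.
  by rewrite -sumrN; apply: eq_bigr => p _; rewrite mulrN1 !mulNr.
- move=> y ry; rewrite oppr_ge0 (le_trans (hhi _ (le_trans (ltW r0) (ltW ry))))//.
  rewrite (max_idPl _) ?powR0 ?mulr0 ?gt_eqF//.
  by rewrite subr_le0 ler_pdivlMr// mul1r ltW.
- by move=> y y0 yr; rewrite mulNr lerN2 hlo.
- by apply: integrable_mulrl => //; exact: ig.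
rewrite RintegralZl//; last exact: ig.
rewrite !mulNr lerN2 ler_pM2l//; apply: le_trans.
(* Paths with X_t > r do not count, the profile at scale r - 1 being 0 there. *)
rewrite /W /Rintegral (integral_subset_eq0 _ _ _ _ _ (A `&` X t @^-1` `]-oo, r]))//.
move=> w Aw nXr; rewrite (max_idPl _) ?powR0 ?gt_eqF// subr_le0 ler_pdivlMr// mul1r.
have : r < X t w by rewrite ltNge; apply/negP => Xr; apply: nXr; split => //=; rewrite in_itv.
by lra.
Qed.

(** With b = r + M, near harmonicity holds up to b - M = r; the extra 1 makes b < c. *)
Lemma stay_below_forever_le_defect r : 0 < r ->
  fine (P x (stay_below_forever X t r A)) <= W (r + M + 1).
Proof.
move=> r0; have b0 : 0 < r + M by rewrite ltr_wpDr.
have c0 : 0 < r + M + 1 by rewrite addr_gt0.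
have [|h [h0 hlo hhi happ]] := barrier (r + M) (r + M + 1) b0; first by rewrite ltrDl.
have := stay_below_forever_le _ _ _ tame markov _ vsol laplace x t r A x0 t0 (ltW r0) FA
  Xrcll h (fun y => h 0 * Num.max 0 (1 - y / (r + M + 1)) `^ a).
move=> /(_ _ _ _ _)/wrap[].
- move=> eps eps0; have [q [q0 qh _ qhi]] := happ _ eps0.
  by exists q; split => // y y0 yr; apply: qhi => //; rewrite addrK.
- move=> y ry; apply: le_trans (hlo _ (le_trans (ltW r0) (ltW ry))).
  by rewrite mulr_ge0 ?powR_ge0// ltW.
- by move=> y y0 yr; exact: hhi.
- by apply: integrable_mulrl => //; exact: ig.
rewrite RintegralZl//; last exact: ig.
rewrite ler_pM2l// => /le_trans; apply.
rewrite /W /Rintegral fine_le//.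
- by apply: integrable_fin_num => //; exact: ig.
- by apply: integrable_fin_num => //; exact: ig.
apply: ge0_subset_integral => //.
- by apply/measurable_EFinP; exact: mg.
by move=> w _; rewrite lee_fin powR_ge0.
Qed.

Let WE s : 0 < s ->
  s * (fine (P x A) - W s) = \int[P x]_(w in A) defect a s (X t w).
Proof.
move=> s0; rewrite /defect RintegralZl//; last first.
  by apply: integrable_subr => //; [exact: finite_measure_integrable_cst|exact: ig].
rewrite RintegralB//; [|exact: finite_measure_integrable_cst|exact: ig].
by rewrite Rintegral_cst// mul1r.
Qed.

Let defect_int_cvg :
  \int[P x]_(w in A) defect a s (X t w) @[s --> +oo] --> a * \int[P x]_(w in A) X t w.
Proof.
apply/cvg_pinftyP => u uy.
have iX : (P x).-integrable A (EFin \o X t).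
  exact: (integrableX _ _ _ tame markov _ vsol laplace).
rewrite -RintegralZl//.
apply: fine_cvg; rewrite fineK; last first.
  by apply: integrable_fin_num => //; exact: integrable_mulrl.
(* The bounds on the defect ask for s > 0, so the sequence is shifted past its first terms. *)
have [N _ HN] : \forall n \near \oo, 0 < u n by move/cvgryPgt : uy; apply.
rewrite -(cvg_shiftn N).
have uN n : 0 < u (n + N)%N by apply: HN => /=; exact: leq_addl.
apply: (@dominated_cvg _ _ _ _ _ mA _ _ (EFin \o X t)) => //.
- move=> n; apply/measurable_EFinP/measurable_funM => //.
  by apply: measurable_funB => //; exact: mg.
- move=> w Aw; apply: cvg_EFin; first exact: nearW.
  apply: (cvg_comp _ _ _ (defect_cvg _ _ a0 a1 (X0 w))).
  by rewrite (cvg_shiftn N u).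
- move=> n w Aw; rewrite /= lee_fin.
  by have /andP[D0 DX] := defect_bounds _ _ _ a0 a1 (uN n) (X0 w); rewrite ger0_norm.
Qed.

Lemma exceed_asymptotics :
  r * (fine (P x A) - fine (P x (stay_below_forever X t r A))) @[r --> +oo] -->
    a * \int[P x]_(w in A) X t w.
Proof.
have inv0 : (s^-1 : R) @[s --> +oo] --> (0 : R) := cvgr_inv_pinfty.
have shift (c : R) : (r + c : R) @[r --> +oo] --> +oo.
  apply/cvgryPge => B; near=> r; rewrite -lerBlDr; near: r;
    apply: nbhs_pinfty_ge; exact: num_real.
pose D s := \int[P x]_(w in A) defect a s (X t w).
(* The prefactors are r/s for s = r + M + 1 and s = r - 1, written so that their limit 1 is
   visible. *)
apply: (@squeeze_cvgr _ _ _ _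
  (fun r => (1 - (M + 1) * (r + (M + 1))^-1) * D (r + (M + 1)))
  (fun r => (1 + (r + (- 1))^-1) * D (r + (- 1)))).
- near=> r; have r1 : 1 < r by near: r; exact: nbhs_pinfty_gt.
  have r0 : 0 < r by exact: lt_trans r1.
  have s0 : 0 < r + (M + 1) by rewrite addr_gt0// ltr_wpDl.
  have s1 : 0 < r + (- 1) by rewrite subr_gt0.
  rewrite /D -!WE//; apply/andP; split.
    rewrite mulrA (_ : (1 - _) * _ = r); last by field; rewrite gt_eqF.
    by rewrite ler_wpM2l ?(ltW r0)// lerD2l lerN2 addrA stay_below_forever_le_defect.
  rewrite mulrA (_ : (1 + _) * _ = r); last by field; rewrite gt_eqF.
  by rewrite ler_wpM2l ?(ltW r0)// lerD2l lerN2 stay_below_forever_ge.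
- rewrite -[X in _ --> X]mul1r; apply: cvgM; last exact: cvg_comp (shift _) defect_int_cvg.
  rewrite -[X in _ --> X]subr0; apply: cvgB; first exact: cvg_cst.
  rewrite -[X in _ --> X](mulr0 (M + 1)); apply: cvgMr.
  exact: cvg_comp (shift _) inv0.
- rewrite -[X in _ --> X]mul1r; apply: cvgM; last exact: cvg_comp (shift _) defect_int_cvg.
  rewrite -[X in _ --> X]addr0; apply: cvgD; first exact: cvg_cst.
  exact: cvg_comp (shift _) inv0.
Unshelve. all: by end_near. Qed.

End fixed_time.
End asymptotics.

Lemma cvg_lincomb {R : realType} (F : set_system R) {FF : Filter F} (I : eqType)
    (s : seq I) (c : I -> R) (f : I -> R -> R) (l : I -> R) :
  (forall i, i \in s -> f i r @[r --> F] --> l i) ->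
  (\sum_(i <- s) c i * f i r : R) @[r --> F] --> \sum_(i <- s) c i * l i.
Proof.
elim: s => [|i s IH] cf.
  by rewrite big_nil; under eq_fun do rewrite big_nil; exact: cvg_cst.
rewrite big_cons; under eq_fun do rewrite big_cons.
apply: cvgD; first by apply: cvgMr; apply: cf; rewrite mem_head.
by apply: IH => j js; apply: cf; rewrite inE js orbT.
Qed.

Lemma sup_exceedsE (R : realType) (d : measure_display) (T : measurableType d)
    (X : R -> {mfun T >-> R}) (r : R) :
  sup_exceeds X r = ~` stay_below_forever X 0 r setT.
Proof.
apply/seteqP; split => w /=.
  move=> rX [_ Xr]; move: rX; rewrite /sup_exceeds/= ltNge => /negP; apply.
  apply: ge_ereal_sup => y [s s0 <-]; rewrite lee_fin; apply: Xr.
  by move: s0; rewrite /= in_itv/= andbT.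
move=> nX; rewrite /sup_exceeds/= ltNge; apply/negP => Xr; apply: nX.
split => // s s0; rewrite -lee_fin; apply: le_trans Xr.
by apply: ereal_sup_ubound; exists s => //=; rewrite in_itv/= andbT.
Qed.

(** Level sets of width eps. A uniform error stays below eps under every conditional law, whatever
    r. *)
Lemma filtration_simple_approx (R : realType) (d : measure_display)
    (T : measurableType d) (X : R -> {mfun T >-> R}) (t : R) (F : T -> R) (C eps : R) :
  filtration_measurable X t F -> (forall w, `|F w| <= C) -> 0 < eps ->
  exists (N : nat) (c : nat -> R) (A : nat -> set T),
    (forall k, natural_filtration X t (A k)) /\
    forall w, `|F w - \sum_(0 <= k < N) c k * \1_(A k) w| <= eps.
Proof.
move=> mF FC eps0.
pose c k : R := - C + k%:R * eps.
pose A k : set T := F @^-1` `[c k, c k + eps[.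
have z0 w : 0 <= (F w + C) / eps.
  by rewrite divr_ge0 ?(ltW eps0)//; have := FC w; rewrite ler_norml => /andP[]; lra.
pose N := (Num.trunc (2 * C / eps)).+1.
exists N, c, A; split => [k|w].
  by apply: mF; exact: measurable_itv.
pose k := Num.trunc ((F w + C) / eps).
have /andP[k1 k2] := truncn_itv (z0 w).
rewrite -/k in k1 k2.
have kN : (k < N)%N.
  rewrite -(ltr_nat R); apply: (le_lt_trans k1); apply: le_lt_trans (truncnS_gt _).
  by rewrite ler_pM2r ?invr_gt0//; have := FC w; rewrite ler_norml => /andP[]; lra.
rewrite ler_pdivlMr// in k1; rewrite ltr_pdivrMr// -natr1 mulrDl mul1r in k2.
have Ak : A k w by rewrite /A/= in_itv/= /c; apply/andP; split; lra.
rewrite big_mkord (bigD1 (Ordinal kN))//= big1 ?addr0; last first.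
  move=> i ik; rewrite indicE memNset ?mulr0// /A/= in_itv/= /c => /andP[i1 i2].
  move/eqP: ik; apply; apply: val_inj => /=.
  apply/eqP; rewrite eqn_leq; apply/andP; split.
    rewrite -ltnS -(ltr_nat R) -(ltr_pM2r eps0) -natr1 mulrDl mul1r; lra.
  rewrite -ltnS -(ltr_nat R) -(ltr_pM2r eps0) -natr1 mulrDl mul1r; lra.
rewrite indicE mem_set// mulr1 /c ger0_norm; lra.
Qed.

(** * Conditioning on the supremum *)

Section conclusion.
Context {R : realType} {d : measure_display} {T : measurableType d}.
Variables (Phi : R -> R) (X : R -> {mfun T >-> R}) (P : R -> probability T R).
Hypotheses (tame : tame_mechanism Phi) (markov : markov_process X P).
Variable v : R -> R -> R.
Hypothesis vsol : forall l, 0 <= l -> cumulant_solution Phi l (v ^~ l).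
Hypothesis laplace : forall x t l : R, 0 <= x -> 0 <= t -> 0 <= l ->
  ('E_(P x)[fun w => expR (- (l * X t w))])%E = (expR (- (x * v t l)))%:E.
Hypothesis Xrcll : forall w, rcll (fun s => X s w).
Variables (a M : R).
Hypotheses (a0 : 0 < a) (a1 : a <= 1) (M0 : 0 <= M).
Hypothesis barrier : barrier_property Phi a M.
Variable x : R.
Hypothesis xp : 0 < x.
Variable t : R.
Hypothesis t0 : 0 <= t.

Let p (B : set T) : R := fine (P x B).
Let D r := sup_exceeds X r.

Let x0 : 0 <= x. Proof. exact: ltW. Qed.
Let X0 w : 0 <= X t w. Proof. exact: markov_ge0 markov _ _ t0. Qed.

Let mS s r A : 0 <= s -> 0 <= r -> natural_filtration X s A ->
  measurable (stay_below_forever X s r A).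
Proof. by move=> s0 r0 FA; exact: (measurable_stay_below_forever _ _ markov). Qed.

Let mD r : 0 <= r -> measurable (D r).
Proof.
move=> r0; rewrite /D sup_exceedsE; apply: measurableC; apply: mS => //.
exact: natural_filtrationT.
Qed.

Let p_ge0 B : 0 <= p B. Proof. exact: fine_ge0. Qed.

Let p_le B B' : measurable B -> measurable B' -> B `<=` B' -> p B <= p B'.
Proof.
move=> mB mB' sub; apply: fine_le; rewrite ?fin_num_measure//.
by apply: le_measure; rewrite ?inE.
Qed.

Let p_split B B' : measurable B -> measurable B' -> p B = p (B `\` B') + p (B `&` B').
Proof.
move=> mB mB'; rewrite /p (measureDI (P x) mB mB') fineD//; apply: fin_num_measure.
  exact: measurableD.
exact: measurableI.
Qed.

Let meanX s : 0 <= s -> \int[P x]_w X s w = x.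
Proof. by move=> s0; rewrite /Rintegral (cb_mean _ _ _ tame markov _ vsol laplace). Qed.

Let exceed_prob_cvg : r * p (D r) @[r --> +oo] --> a * x.
Proof.
have := exceed_asymptotics _ _ _ tame markov _ vsol laplace Xrcll _ _ a0 a1 M0 barrier
  x x0 0 setT (lexx 0) (natural_filtrationT X 0).
rewrite meanX//; apply: cvg_trans; apply: near_eq_cvg; near=> r.
have r0 : 0 <= r by near: r; exact: nbhs_pinfty_ge.
have mS0 := mS 0 r setT (lexx 0) r0 (natural_filtrationT X 0).
congr (_ * _); rewrite -/(p _) -/(p _) (p_split setT _ _ mS0)// setTI addrK.
by rewrite setTD /D sup_exceedsE.
Unshelve. all: by end_near. Qed.

(* r P(sup_s X_s > r) and r P(sup_(s >= t) X_s > r) have the same limit a x since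
   E X_t = x, so exceeding r only before time t has probability o(1/r). *)
Let exceed_prob_on_cvg A : natural_filtration X t A ->
  r * p (A `&` D r) @[r --> +oo] --> a * \int[P x]_(w in A) X t w.
Proof.
move=> FA; have mA := natural_filtration_measurable _ _ _ FA.
have FT := natural_filtrationT X t.
have K1 := exceed_asymptotics _ _ _ tame markov _ vsol laplace Xrcll _ _ a0 a1 M0 barrier
  x x0 t A t0 FA.
have K2 := exceed_asymptotics _ _ _ tame markov _ vsol laplace Xrcll _ _ a0 a1 M0 barrier
  x x0 t setT t0 FT.
rewrite meanX// in K2.
(* From below, the crossings after t; from above, these plus r times the probability, over all of
   Omega, of crossing before t only. *)
apply: (@squeeze_cvgr _ _ _ _ _
  (fun r => r * (p A - p (stay_below_forever X t r A)) +
    (r * p (D r) - r * (p setT - p (stay_below_forever X t r setT)))) _ _ _ K1); last first.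
  rewrite -[X in _ --> X]addr0 -(subrr (a * x)); apply: cvgD => //.
  exact: cvgB.
near=> r.
have r0 : 0 <= r by near: r; exact: nbhs_pinfty_ge.
have mSA := mS t r A t0 r0 FA; have mST := mS t r setT t0 r0 FT.
have mDr := mD r r0.
set S := stay_below_forever X t r setT in mST *.
have SA : stay_below_forever X t r A = A `&` S.
  by apply/seteqP; split => w; [move=> [Aw Xr]; split => //; split|move=> [Aw [_ Xr]]; split].
have SD : ~` S `<=` D r.
  rewrite /D sup_exceedsE; apply: subsetC => w [_ Xr]; split => // s ts.
  by apply: Xr; exact: le_trans ts.
rewrite -/(p _) -/(p _) SA.
have e1 : p A - p (A `&` S) = p (A `\` S) by rewrite (p_split A S)// addrK.
have e2 : p setT - p S = p (~` S) by rewrite (p_split setT S)// setTI addrK setTD.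
have e3 : p (A `&` D r) = p (A `\` S) + p (A `&` D r `&` S).
  rewrite (p_split (A `&` D r) S)//; last exact: measurableI.
  by rewrite !setDE -[A `&` D r `&` ~` S]setIA (setIidr SD).
have e4 : p (D r) = p (~` S) + p (D r `&` S).
  by rewrite (p_split (D r) S)// setDE (setIidr SD).
have e5 : p (A `&` D r `&` S) <= p (D r `&` S).
  by apply: p_le; [do 2 apply: measurableI => //|exact: measurableI|move=> w [[]]].
rewrite e1 e2 e3 e4; apply/andP; split.
  by rewrite ler_wpM2l// lerDl.
by rewrite -mulrBr addrAC subrr add0r -mulrDr ler_wpM2l// lerD2l.
Unshelve. all: by end_near. Qed.

Let exceed_prob_gt0 : \forall r \near +oo, 0 < p (D r).
Proof.
have ax : 0 < a * x by rewrite mulr_gt0.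
have pos : \forall r \near +oo, 0 < r * p (D r).
  by move/cvgr_gt : exceed_prob_cvg; apply.
near=> r.
have r0 : 0 < r by near: r; exact: nbhs_pinfty_gt.
by rewrite -(pmulr_rgt0 _ r0); near: r.
Unshelve. all: by end_near. Qed.

(** In the quotient of the two asymptotics the constant [a] cancels, so both cases have the same
    limit. *)
Let conditional_prob_cvg A : natural_filtration X t A ->
  p (A `&` D r) / p (D r) @[r --> +oo] --> x^-1 * \int[P x]_(w in A) X t w.
Proof.
move=> FA; have ax : a * x != 0 by rewrite gt_eqF// mulr_gt0.
have : r * p (A `&` D r) * (r * p (D r))^-1 @[r --> +oo] -->
    a * (\int[P x]_(w in A) X t w) * (a * x)^-1.
  by apply: cvgM; [exact: exceed_prob_on_cvg|exact: cvgV].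
rewrite (_ : a * _ * (a * x)^-1 = x^-1 * \int[P x]_(w in A) X t w); last first.
  by field; rewrite !gt_eqF.
apply: cvg_trans; apply: near_eq_cvg; near=> r.
have r0 : 0 < r by near: r; exact: nbhs_pinfty_gt.
have pD : 0 < p (D r) by near: r.
by field; rewrite !gt_eqF.
Unshelve. all: by end_near. Qed.

Variable F : T -> R.
Hypotheses (mF : filtration_measurable X t F) (bF : bounded_fun F).

(** Three errors eps/3: [F] against a simple function under the conditional law, the convergence for
    that function, and [F] against it under the density X_t/x, whose total mass is 1. *)
Lemma conditional_expectation_cvg :
  (\int[P x]_(w in D r) F w) / p (D r) @[r --> +oo] -->
    x^-1 * \int[P x]_w (X t w * F w).
Proof.
have [C FC] : exists C : R, forall w, `|F w| <= C.
  have [C0 [_ HC]] := bF; exists (C0 + 1) => w; apply: HC => //.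
  by rewrite ltrDl.
have mF' : measurable_fun setT F.
  move=> _ B mB; rewrite setTI.
  exact: natural_filtration_measurable (mF _ mB).
have iF B : measurable B -> (P x).-integrable B (EFin \o F).
  by move=> mB; apply: (bounded_integrable_prob _ _ _ _ _ _ C) => //; exact: measurable_funTS.
have iX : (P x).-integrable setT (EFin \o X t).
  exact: (integrableX _ _ _ tame markov _ vsol laplace).
have iXb (G : T -> R) K : measurable_fun setT G -> (forall w, `|G w| <= K) ->
    (P x).-integrable setT (EFin \o (fun w => X t w * G w)).
  move=> mG GK.
  apply: (le_integrable measurableT _ _ (integrable_mulrl _ _ _ _ _ _ K measurableT iX)).
    by apply/measurable_EFinP/measurable_funM.
  move=> w _; rewrite lee_fin normrM (ger0_norm (X0 w)) mulrC.
  rewrite (le_trans (ler_wpM2r (X0 w) (GK w)))// ler_norm//.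
apply/cvgrPdist_le => eps eps0.
have e30 : 0 < eps / 3 by rewrite divr_gt0.
have [N [c [A [FA FF']]]] := filtration_simple_approx _ _ _ _ _ _ _ _ mF FC e30.
have mA k : measurable (A k) := natural_filtration_measurable _ _ _ (FA k).
pose G w := \sum_(0 <= k < N) c k * \1_(A k) w.
have mG : measurable_fun setT G.
  by apply: measurable_sum => k; exact: measurable_funM.
have GC w : `|G w| <= C + eps / 3.
  rewrite (_ : G w = F w - (F w - G w)); last by ring.
  by rewrite (le_trans (ler_normB _ _))// lerD.
have iG B : measurable B -> (P x).-integrable B (EFin \o G).
  by move=> mB; apply: (bounded_integrable_prob _ _ _ _ _ _ (C + eps / 3)) => //;
    exact: measurable_funTS.
have GE B : measurable B -> \int[P x]_(w in B) G w = \sum_(0 <= k < N) c k * p (A k `&` B).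
  move=> mB.
  have [|_ ->] := integrable_lincomb _ _ _ (P x) B _ (index_iota 0 N) c (fun k => \1_(A k)) mB.
    move=> k _; apply: (bounded_integrable_prob _ _ _ _ _ _ 1) => // w _.
    by rewrite indicE; case: (_ \in _); rewrite ?normr1 ?normr0.
  by apply: eq_bigr => k _; rewrite /Rintegral integral_indic.
have XGE : \int[P x]_w (X t w * G w) = \sum_(0 <= k < N) c k * \int[P x]_(w in A k) X t w.
  have -> : (fun w => X t w * G w) = (fun w => \sum_(0 <= k < N) c k * (X t w * \1_(A k) w)).
    by apply/funext => w; rewrite /G mulr_sumr; apply: eq_bigr => k _; rewrite mulrCA.
  have [|_ ->] := integrable_lincomb _ _ _ (P x) setT _ (index_iota 0 N) c
      (fun k w => X t w * \1_(A k) w) measurableT.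
    move=> k _; apply: (iXb _ 1) => // w.
    by rewrite indicE; case: (_ \in _); rewrite ?normr1 ?normr0.
  by apply: eq_bigr => k _; rewrite [in RHS]Rintegral_mkcond patch_indic.
have cG : (\int[P x]_(w in D r) G w) / p (D r) @[r --> +oo] -->
    x^-1 * \int[P x]_w (X t w * G w).
  rewrite XGE mulr_sumr.
  under eq_bigr do rewrite mulrCA.
  have : (\sum_(0 <= k < N) c k * (p (A k `&` D r) / p (D r)) : R) @[r --> +oo] -->
      \sum_(0 <= k < N) c k * (x^-1 * \int[P x]_(w in A k) X t w).
    by apply: cvg_lincomb => k _; exact: conditional_prob_cvg.
  apply: cvg_trans; apply: near_eq_cvg; near=> r.
  have r0 : 0 <= r by near: r; exact: nbhs_pinfty_ge.
  by rewrite (GE _ (mD _ r0)) mulr_suml; apply: eq_bigr => k _; rewrite mulrA.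
have XFG : `|x^-1 * \int[P x]_w (X t w * F w) - x^-1 * \int[P x]_w (X t w * G w)| <= eps / 3.
  have iXF := iXb _ _ mF' FC; have iXG := iXb _ _ mG GC.
  rewrite -mulrBr normrM ger0_norm ?invr_ge0// -RintegralB//.
  rewrite mulrC ler_pdivrMr//.
  apply: (le_trans (le_normr_Rintegral _ _)) => //; first exact: integrable_subr.
  rewrite -[in leRHS](meanX t t0) -RintegralZl//.
  apply: le_Rintegral => //.
  - by apply: integrable_norm; exact: integrable_subr.
  - exact: integrable_mulrl.
  - by move=> w _; rewrite -mulrBr normrM ger0_norm// mulrC ler_wpM2r.
near=> r.
have r0 : 0 <= r by near: r; exact: nbhs_pinfty_ge.
have pD : 0 < p (D r) by near: r.
have DFG : `|(\int[P x]_(w in D r) F w) / p (D r) -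
    (\int[P x]_(w in D r) G w) / p (D r)| <= eps / 3.
  have mDr := mD r r0; have iFD := iF _ mDr; have iGD := iG _ mDr.
  have ip0 : 0 <= (p (D r))^-1 by rewrite invr_ge0 ltW.
  rewrite -mulrBl normrM (ger0_norm ip0) -RintegralB//.
  rewrite ler_pdivrMr//.
  apply: (le_trans (le_normr_Rintegral _ _)) => //; first exact: integrable_subr.
  rewrite -Rintegral_cst//; apply: le_Rintegral => //.
  - by apply: integrable_norm; exact: integrable_subr.
  - exact: finite_measure_integrable_cst.
have h3 : `|x^-1 * \int[P x]_w (X t w * G w) - (\int[P x]_(w in D r) G w) / p (D r)| <= eps / 3.
  by near: r; exact: cvgr_dist_le cG _ e30.
move: XFG DFG h3.
set u1 := x^-1 * _; set u2 := x^-1 * _; set u3 := _ / p _; set u4 := _ / p _.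
by rewrite !ler_norml => /andP[? ?] /andP[? ?] /andP[? ?]; apply/andP; split; lra.
Unshelve. all: by end_near. Qed.

Lemma cond_expectation_cvg :
  cond_expectation (P x) F (sup_exceeds X r) @[r --> +oo] -->
    ((x^-1)%:E * 'E_(P x)[fun w => (X t w * F w)%R])%E.
Proof.
have [C FC] : exists C : R, forall w, `|F w| <= C.
  have [C0 [_ HC]] := bF; exists (C0 + 1) => w; apply: HC => //.
  by rewrite ltrDl.
have mF' : measurable_fun setT F.
  move=> _ B mB; rewrite setTI.
  exact: natural_filtration_measurable (mF _ mB).
have iX : (P x).-integrable setT (EFin \o X t).
  exact: (integrableX _ _ _ tame markov _ vsol laplace).
have iXF : (P x).-integrable setT (EFin \o (fun w => X t w * F w)).
  apply: (le_integrable measurableT _ _ (integrable_mulrl _ _ _ _ _ _ C measurableT iX)).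
    by apply/measurable_EFinP/measurable_funM.
  move=> w _; rewrite lee_fin normrM (ger0_norm (X0 w)) mulrC.
  rewrite (le_trans (ler_wpM2r (X0 w) (FC w)))// ler_norm//.
have -> : ((x^-1)%:E * 'E_(P x)[fun w => (X t w * F w)%R] =
    (x^-1 * \int[P x]_w (X t w * F w))%:E)%E.
  by rewrite unlock EFinM /Rintegral fineK//; exact: integrable_fin_num.
have E r : 0 <= r -> 0 < p (D r) -> cond_expectation (P x) F (sup_exceeds X r) =
    ((\int[P x]_(w in D r) F w) / p (D r))%:E.
  move=> r0 pD; rewrite /cond_expectation unlock.
  have mDr := mD r r0.
  rewrite (_ : (fun w => (F w * \1_(sup_exceeds X r) w)%:E) =
    (EFin \o (F \_ (D r)))); last first.
    by apply/funext => w; rewrite /= patch_indic.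
  rewrite -restrict_EFin -integral_mkcond EFinM /Rintegral fineK//; last first.
    apply: integrable_fin_num => //; apply: (bounded_integrable_prob _ _ _ _ _ _ C) => //.
    exact: measurable_funTS.
  (* The extended inverse is the real one because P(D r) is nonzero. *)
  congr (_ * _)%E; rewrite -[in LHS](fineK (fin_num_measure (P x) _ mDr)).
  by rewrite inver gt_eqF.
have cE : ((\int[P x]_(w in D r) F w) / p (D r))%:E @[r --> +oo] -->
    (x^-1 * \int[P x]_w (X t w * F w))%:E.
  by apply: cvg_EFin; [exact: nearW|exact: conditional_expectation_cvg].
apply: cvg_trans cE.
apply: near_eq_cvg; near=> r; apply/esym/E; last by near: r.
by near: r; exact: nbhs_pinfty_ge.
Unshelve. all: by end_near. Qed.

End conclusion.

Theorem proposition4p8 (R : realType) (d : measure_display)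
    (T : measurableType d) (alpha beta : R) (nu : {measure set R -> \bar R})
    (X : R -> {mfun T >-> R}) (P : R -> probability T R) (x : R) :
  0 <= beta ->
  levy_measure nu ->
  (exists2 lambda : R, 0 <= lambda &
     branching_mechanism alpha beta nu lambda != 0) ->
  cb_process (branching_mechanism alpha beta nu) X P ->
  0 < x ->
  (alpha = 0 /\ bounded_set (measure_support nu)) \/
  (exists c gamma : R, [/\ 0 < c, 1 < gamma, gamma <= 2 &
     forall lambda : R, 0 <= lambda ->
       branching_mechanism alpha beta nu lambda = c * lambda `^ gamma]) ->
  forall (t : R) (F : T -> R),
    0 <= t -> filtration_measurable X t F -> bounded_fun F ->
    cond_expectation (P x) F (sup_exceeds X r) @[r --> +oo] -->
      ((x^-1)%:E * 'E_(P x)[fun w => (X t w * F w)%R])%E.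
Proof.
move=> beta0 levy_nu Phi_neq0 [markov Xrcll [v [vsol laplace]]] x0 cases t F t0 mF bF.
(* Bounded jumps: a = 1, with [M] a bound for the jumps. Power: a = gamma - 1 and M = 0, where gamma
   <= 2 becomes a <= 1. *)
have [tame [a [M [a0 a1 M0 barrier]]]] :
    tame_mechanism (branching_mechanism alpha beta nu) /\
    exists a M : R, [/\ 0 < a, a <= 1, 0 <= M &
      barrier_property (branching_mechanism alpha beta nu) a M].
  case: cases => [[alpha0 supp]|[c [gamma [c0 g1 g2 PhiE]]]].
    have [M M0 nuM] := bounded_support_null _ supp.
    rewrite alpha0 in Phi_neq0 *; split; first exact: tame_bounded_jumps nuM Phi_neq0.
    exists 1, M; split => //; first exact: ltW.
    exact: barrier_bounded_jumps.
  split; first exact: tame_stable PhiE.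
  exists (gamma - 1), 0; split => //; rewrite ?subr_gt0 ?lerBlDr//.
  apply: (barrier_stable c) => //; [exact: ltW|lra|lra|].
  by move=> l l0; rewrite PhiE// addrC subrK.
exact: (cond_expectation_cvg _ _ _ tame markov _ vsol laplace Xrcll _ _ a0 a1 M0 barrier).
Qed.
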